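(* Let $\zeta_0,\xi_0\in\mathbb{T}$ with $\zeta_0\ne\xi_0$, and let $f$ be analytic on the unit disk $\mathbb{D}$ with $|f(0)|=1$, satisfying for some $K>0$ and $p,q,r\ge0$ $$\log|f(z)|\le\frac{K}{(1-|z|)^p}\,\frac{|z-\zeta_0|^r}{|z-\xi_0|^q}, \qquad z\in\mathbb{D}.$$ Then for every $\varepsilon>0$ there is a positive number $C_5=C_5(\zeta_0,\xi_0,p,q,r,\varepsilon)$ such that $$\sum_{\zeta\in Z(f)} (1-|\zeta|)^{p+1+\varepsilon}\,\frac{|\zeta-\xi_0|^{(q-1+\varepsilon)_+}}{|\zeta-\zeta_0|^{\min(p,r)}}\le C_5\cdot K.$$
   Context: $\mathbb{T}$ is the unit circle. $Z(f)$ denotes the zero set of $f$ in $\mathbb{D}$, counted with multiplicities; $a_+:=\max(a,0)$. *)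

(* Defs.v *)
From mathcomp Require Import all_boot all_order all_algebra.
From mathcomp Require Import all_classical all_reals all_analysis.
From mathcomp Require Export complex.
Import Order.TTheory GRing.Theory Num.Theory.
Local Open Scope classical_set_scope.
Local Open Scope ring_scope.

Definition cabs {R : realType} (z : R[i]) : R :=
  Num.sqrt (complex.Re z ^+ 2 + complex.Im z ^+ 2).

Definition ccvg {R : realType} (u : nat -> R[i]) (l : R[i]) : Prop :=
  forall e : R, 0 < e -> exists N : nat, forall n : nat, (N <= n)%N ->
    cabs (u n - l) < e.

Definition analytic_on_disk {R : realType} (f : R[i] -> R[i]) : Prop :=
  exists a : nat -> R[i], forall z : R[i], cabs z < 1 ->
    ccvg (fun N => \sum_(n < N) a n * z ^+ n) (f z).

Definition vanishes_to {R : realType} (f : R[i] -> R[i]) (w : R[i]) (k : nat)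
  : Prop :=
  exists g : R[i] -> R[i], analytic_on_disk g /\
    forall z : R[i], cabs z < 1 -> f z = (z - w) ^+ k * g z.

(* Z(f) counted with multiplicities: a zero w of multiplicity m contributes
   the m pairs (w,1),...,(w,m) *)
Definition zeros_mult {R : realType} (f : R[i] -> R[i]) : set (R[i] * nat) :=
  [set x | cabs x.1 < 1 /\ (0 < x.2)%N /\ vanishes_to f x.1 x.2].

Definition pospart {R : realType} (a : R) : R := Num.max a 0.

(* Main.v *)
Require Import Defs.
From mathcomp Require Import all_boot all_order all_algebra.
From mathcomp Require Import all_classical all_reals all_analysis.
From mathcomp Require Import complex ring lra.
Import Order.TTheory GRing.Theory Num.Theory.
Import numFieldNormedType.Exports.
Local Open Scope classical_set_scope.
Local Open Scope ring_scope.

Set Implicit Arguments.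
Unset Strict Implicit.
Unset Printing Implicit Defensive.

(** Fix a dyadic scale [1 - |w| ~ 2^-k] and consider the zeros [w] of [f] at this
    scale whose distance to [xi] (or to [zeta]) is [~ 2^-J].  On a region [X] of
    the disk of radius [1 - 2^-(k+2)] containing 0 and these zeros, and avoiding
    the bad points of the growth bound, compare [log |f|] plus the Green
    functions of the zeros with a harmonic function [Re G]: the maximum
    principle on [X] evaluated at 0 gives [sum (1 - |w|) <= 2 Re (G 0)].
    Near [xi], [X] omits the disk of radius [2^-J] about [xi]; near [zeta], away
    from the zeros, [X] stays at height [eta |z - zeta|] above the circle.  On
    the new part of the boundary the Green functions do not vanish, but they are
    bounded by a small multiple of [T = sum (1 - |w|)] times a harmonic function,
    so that their contribution to [Re (G 0)] is absorbed by the left-hand side.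
    The [eps] in the exponents makes the sum over all scales converge.

    The maximum principle needs neither integrals nor the Cauchy theory: if [F]
    and [G] have second-order complex Taylor expansions at [z], the mean of
    [|F| exp(- Re G)] over [z + s, z - s, z + i s, z - i s] is at least its value
    at [z] up to [O(s^3)], which excludes interior maxima after adding
    [d |z|^2]. *)

(** * Second-order expansions and submean values *)

Section ComplexModulus.
Context {R : realType}.
Implicit Types (z w : R[i]).

Lemma cabs_normc z : cabs z = ComplexField.Normc.normc z.
Proof. by case: z. Qed.

Lemma cabs0 : cabs (0 : R[i]) = 0.
Proof. by rewrite cabs_normc ComplexField.Normc.normc0. Qed.

Lemma cabs1 : cabs (1 : R[i]) = 1.
Proof. by rewrite cabs_normc ComplexField.Normc.normc1. Qed.

Lemma cabsM z w : cabs (z * w) = cabs z * cabs w.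
Proof. by rewrite !cabs_normc ComplexField.Normc.normcM. Qed.

Lemma cabsV z : cabs z^-1 = (cabs z)^-1.
Proof. by rewrite !cabs_normc ComplexField.Normc.normcV. Qed.

Lemma cabsN z : cabs (- z) = cabs z.
Proof. by rewrite /cabs; case: z => a b /=; rewrite !sqrrN. Qed.

Lemma cabs_ge0 z : 0 <= cabs z.
Proof. exact: sqrtr_ge0. Qed.

Lemma cabs_eq0 z : (cabs z == 0) = (z == 0).
Proof.
apply/eqP/eqP => [|->]; last exact: cabs0.
by rewrite cabs_normc => /ComplexField.Normc.eq0_normc.
Qed.

Lemma cabs_gt0 z : (0 < cabs z) = (z != 0).
Proof. by rewrite lt_def cabs_eq0 cabs_ge0 andbT. Qed.

Lemma cabsD z w : cabs (z + w) <= cabs z + cabs w.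
Proof.
have := ler_normD z w; rewrite !normc_def -rmorphD/=.
by rewrite lecR.
Qed.

Lemma cabsBC z w : cabs (z - w) = cabs (w - z).
Proof. by rewrite -cabsN opprB. Qed.

Lemma cabsB_ge z w : cabs z - cabs w <= cabs (z - w).
Proof. by rewrite lerBlDr -{1}(subrK w z) cabsD. Qed.

Lemma cabsX z n : cabs (z ^+ n) = cabs z ^+ n.
Proof. by elim: n => [|n IH]; rewrite ?cabs1// !exprS cabsM IH. Qed.

Lemma cabs_sum (I : Type) (s : seq I) (P : pred I) (F : I -> R[i]) :
  cabs (\sum_(i <- s | P i) F i) <= \sum_(i <- s | P i) cabs (F i).
Proof.
elim/big_rec2: _ => [|i y x _ h]; first by rewrite cabs0.
by rewrite (le_trans (cabsD _ _))// lerD2l.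
Qed.

Lemma cabs_prod (I : Type) (s : seq I) (P : pred I) (F : I -> R[i]) :
  cabs (\prod_(i <- s | P i) F i) = \prod_(i <- s | P i) cabs (F i).
Proof. by apply: (big_morph cabs); [exact: cabsM|exact: cabs1]. Qed.

Lemma sqr_cabs z : cabs z ^+ 2 = complex.Re z ^+ 2 + complex.Im z ^+ 2.
Proof. by rewrite sqr_sqrtr// addr_ge0// sqr_ge0. Qed.

Lemma Re_le_cabs z : `|complex.Re z| <= cabs z.
Proof.
rewrite -(@ler_pXn2r _ 2)// ?nnegrE ?cabs_ge0//.
by rewrite sqr_cabs real_normK ?num_real// lerDl sqr_ge0.
Qed.

Lemma Im_le_cabs z : `|complex.Im z| <= cabs z.
Proof.
rewrite -(@ler_pXn2r _ 2)// ?nnegrE ?cabs_ge0//.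
by rewrite sqr_cabs real_normK ?num_real// lerDr sqr_ge0.
Qed.

Lemma cabs_le_ReIm z : cabs z <= `|complex.Re z| + `|complex.Im z|.
Proof.
rewrite -(@ler_pXn2r _ 2)// ?nnegrE ?cabs_ge0 ?addr_ge0//.
rewrite sqr_cabs sqrrD !real_normK ?num_real// lerD2r lerDl.
by rewrite mulrn_wge0// mulr_ge0.
Qed.

Lemma cabs_real (x : R) : cabs (x%:C)%C = `|x|.
Proof. by rewrite /cabs/= expr0n/= addr0 sqrtr_sqr. Qed.

Lemma cabs_real_ge0 (x : R) : 0 <= x -> cabs (x%:C)%C = x.
Proof. by move=> x0; rewrite cabs_real ger0_norm. Qed.

Lemma cabs_nat n : cabs (n%:R : R[i]) = n%:R.
Proof. by rewrite -(rmorph_nat (real_complex R)) cabs_real_ge0. Qed.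

Lemma cabsi : cabs ('i%C : R[i]) = 1.
Proof. by rewrite /cabs/= expr0n/= add0r expr1n sqrtr1. Qed.

Lemma cabsC z : cabs (z^*)%C = cabs z.
Proof. by case: z => a b; rewrite /cabs/= sqrrN. Qed.

End ComplexModulus.

Section SecondOrder.
Context {R : realType}.
Implicit Types (F G E : R[i] -> R[i]) (z w h : R[i]).

Definition locally_bounded E := exists C r : R, 0 < r /\
  forall h, cabs h < r -> cabs (E h) <= C.

(** The identity holds for every [h] because [E h] may be defined by division when [h] is nonzero.
    The only content is the bound on [E] near 0, so closure under sums and products reduces to
    [ring] identities. *)
Definition second_order F z := exists c1 c2 E, locally_bounded E /\
  forall h, F (z + h) = F z + c1 * h + c2 * h ^+ 2 + E h * h ^+ 3.

Lemma locally_bounded_cst c : locally_bounded (fun=> c).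
Proof. by exists (cabs c), 1; split. Qed.

Lemma locally_bounded_id : locally_bounded id.
Proof. by exists 1, 1; split => // h /ltW. Qed.

Lemma locally_boundedD E1 E2 : locally_bounded E1 -> locally_bounded E2 ->
  locally_bounded (fun h => E1 h + E2 h).
Proof.
move=> [C1 [r1 [r10 h1]]] [C2 [r2 [r20 h2]]].
exists (C1 + C2), (Num.min r1 r2); split; first by rewrite lt_min r10.
move=> h; rewrite lt_min => /andP[hr1 hr2].
by rewrite (le_trans (cabsD _ _))// lerD// ?h1 ?h2.
Qed.

Lemma locally_boundedM E1 E2 : locally_bounded E1 -> locally_bounded E2 ->
  locally_bounded (fun h => E1 h * E2 h).
Proof.
move=> [C1 [r1 [r10 h1]]] [C2 [r2 [r20 h2]]].
exists (C1 * C2), (Num.min r1 r2); split; first by rewrite lt_min r10.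
move=> h; rewrite lt_min => /andP[hr1 hr2].
by rewrite cabsM ler_pM// ?cabs_ge0// ?h1 ?h2.
Qed.

Ltac locally_bounded_tac :=
  lazymatch goal with
  | |- locally_bounded (fun h => @?A h + @?B h) =>
      apply: (@locally_boundedD A B); locally_bounded_tac
  | |- locally_bounded (fun h => @?A h * @?B h) =>
      apply: (@locally_boundedM A B); locally_bounded_tac
  | |- locally_bounded (fun h => h) => exact: locally_bounded_id
  | |- locally_bounded (fun h => ?c) => first [assumption | exact: (locally_bounded_cst c)]
  | |- _ => assumption
  end.

Lemma second_order_cst c z : second_order (fun=> c) z.
Proof.
exists 0, 0, (fun=> 0); split; first exact: locally_bounded_cst.
by move=> h; ring.
Qed.

Lemma second_order_id z : second_order id z.
Proof.
exists 1, 0, (fun=> 0); split; first exact: locally_bounded_cst.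
by move=> h; ring.
Qed.

Lemma second_orderD F G z : second_order F z -> second_order G z ->
  second_order (fun x => F x + G x) z.
Proof.
move=> [c1 [c2 [E [hE hF]]]] [d1 [d2 [E' [hE' hG]]]].
exists (c1 + d1), (c2 + d2), (fun h => E h + E' h).
split; first exact: locally_boundedD.
by move=> h; rewrite hF hG; ring.
Qed.

Lemma second_orderM F G z : second_order F z -> second_order G z ->
  second_order (fun x => F x * G x) z.
Proof.
move=> [c1 [c2 [E [hE hF]]]] [d1 [d2 [E' [hE' hG]]]].
exists (F z * d1 + c1 * G z), (F z * d2 + c1 * d1 + c2 * G z),
  (fun h => (c1 * d2 + c2 * d1) + c2 * d2 * h
    + E h * (G z + d1 * h + d2 * (h * h)) + E' h * (F z + c1 * h + c2 * (h * h))
    + E h * (E' h * (h * (h * h)))).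
split; last by move=> h; rewrite hF hG; ring.
by locally_bounded_tac.
Qed.

Lemma second_orderX F z n : second_order F z ->
  second_order (fun x => F x ^+ n) z.
Proof.
move=> hF; elim: n => [|n IH]; first exact: second_order_cst.
under eq_fun do rewrite exprS.
exact: second_orderM.
Qed.

Lemma second_order_prod (I : Type) (s : seq I) (P : pred I)
    (F : I -> R[i] -> R[i]) z :
  (forall i, P i -> second_order (F i) z) ->
  second_order (fun x => \prod_(i <- s | P i) F i x) z.
Proof.
move=> hF; elim: s => [|i s IH].
  by under eq_fun do rewrite big_nil; exact: second_order_cst.
under eq_fun do rewrite big_cons.
by case: (P i) (hF i) => // Fi; apply: second_orderM => //; exact: Fi.
Qed.

Lemma second_order_sum (I : Type) (s : seq I) (P : pred I)
    (F : I -> R[i] -> R[i]) z :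
  (forall i, P i -> second_order (F i) z) ->
  second_order (fun x => \sum_(i <- s | P i) F i x) z.
Proof.
move=> hF; elim: s => [|i s IH].
  by under eq_fun do rewrite big_nil; exact: second_order_cst.
under eq_fun do rewrite big_cons.
by case: (P i) (hF i) => // Fi; apply: second_orderD => //; exact: Fi.
Qed.

Lemma second_order_near F G z r : 0 < r ->
  (forall h, cabs h < r -> F (z + h) = G (z + h)) ->
  second_order G z -> second_order F z.
Proof.
move=> r0 FG [c1 [c2 [E [[C [s [s0 hE]]] hG]]]].
(* Outside the ball where [F] and [G] agree, the remainder is whatever makes the identity true;
   boundedness is only tested inside. *)
exists c1, c2, (fun h => if cabs h < r then E h else
   (F (z + h) - F z - c1 * h - c2 * h ^+ 2) / h ^+ 3); split.
  exists C, (Num.min r s); split; first by rewrite lt_min r0.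
  by move=> h; rewrite lt_min => /andP[-> /hE].
move=> h; have FGz : F z = G z by have := FG 0; rewrite cabs0 addr0; apply.
case: ifPn => hr; first by rewrite FG// hG FGz.
rewrite mulfVK; first by ring.
rewrite expf_neq0// -cabs_eq0; apply/eqP => h0.
by move: hr; rewrite h0 r0.
Qed.

Lemma second_orderV_affine (a b : R[i]) z : a + b * z != 0 ->
  second_order (fun x => (a + b * x)^-1) z.
Proof.
move=> n0; set v := a + b * z in n0.
have v0 : 0 < cabs v by rewrite cabs_gt0.
pose r := cabs v / 2 / (cabs b + 1).
have b1 : 0 < cabs b + 1 by rewrite ltr_wpDl// cabs_ge0.
have r0 : 0 < r by rewrite !divr_gt0.
have hv h : cabs h < r -> cabs v / 2 <= cabs (v + b * h).
  move=> hr; rewrite -[b * h]opprK.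
  apply: le_trans (cabsB_ge _ _); rewrite cabsN cabsM.
  have : cabs b * cabs h <= cabs v / 2.
    rewrite (le_trans (_ : _ <= (cabs b + 1) * r))//.
      by rewrite ler_pM ?cabs_ge0// ?(ltW hr)// lerDl.
    by rewrite /r mulrC divfK// gt_eqF.
  lra.
(* This is the geometric expansion of [(v + b h)^-1] with its exact remainder. It fails where the
   denominator vanishes (the inverse of 0 is 0), hence the restriction to [cabs h < r], where
   [v + b h] has modulus at least half that of [v]. *)
apply: (@second_order_near _ (fun x => v^-1 + (- b / v ^+ 2) * (x - z)
  + (b ^+ 2 / v ^+ 3) * (x - z) ^+ 2
  + (- b ^+ 3 / v ^+ 3 / (a + b * x)) * (x - z) ^+ 3) _ _ r0) => [h hr|].
  have eqv : a + b * (z + h) = v + b * h by rewrite /v; ring.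
  have nz : v + b * h != 0.
    by rewrite -cabs_gt0 (lt_le_trans _ (hv _ hr))// divr_gt0.
  by rewrite eqv [z + h]addrC addrK; field; rewrite nz n0.
exists (- b / v ^+ 2), (b ^+ 2 / v ^+ 3),
  (fun h => - b ^+ 3 / v ^+ 3 / (v + b * h)); split; last first.
  move=> h; have eqv : a + b * (z + h) = v + b * h by rewrite /v; ring.
  by rewrite eqv subrr [z + h]addrC addrK !expr0n/= !mulr0 !addr0.
apply: locally_boundedM; first exact: locally_bounded_cst.
exists (cabs v / 2)^-1, r; split => // h hr.
rewrite cabsV lef_pV2 ?hv// posrE ?divr_gt0//.
by rewrite (lt_le_trans _ (hv _ hr))// divr_gt0.
Qed.

Lemma second_order_lipschitz F z : second_order F z ->
  exists C r : R, [/\ 0 <= C, 0 < r &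
    forall h, cabs h < r -> cabs (F (z + h) - F z) <= C * cabs h].
Proof.
move=> [c1 [c2 [E [hE hF]]]].
have [C [r [r0 hB]]] : locally_bounded (fun h => c1 + c2 * h + E h * (h * h)).
  by locally_bounded_tac.
exists C, r; split => //; first by rewrite (le_trans _ (hB 0 _)) ?cabs_ge0 ?cabs0.
move=> h hr; have -> : F (z + h) - F z = (c1 + c2 * h + E h * (h * h)) * h.
  by rewrite hF; ring.
by rewrite cabsM ler_wpM2r ?cabs_ge0// hB.
Qed.

Lemma second_order_continuous F z : second_order F z ->
  forall e : R, 0 < e -> exists2 r : R, 0 < r &
    forall h, cabs h < r -> cabs (F (z + h) - F z) < e.
Proof.
move=> /second_order_lipschitz[C [r [C0 r0 lip]]] e e0.
exists (Num.min r (e / (C + 1))).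
  by rewrite lt_min r0 divr_gt0// ltr_wpDl.
move=> h; rewrite lt_min => /andP[hr he].
rewrite (le_lt_trans (lip _ hr))// (le_lt_trans (_ : _ <= (C + 1) * cabs h))//.
  by rewrite ler_wpM2r ?cabs_ge0// lerDl.
by rewrite mulrC -ltr_pdivlMr// ltr_wpDl.
Qed.

(** The increments [s, -s, i s, -i s] have sum 0 and their squares have sum 0, so the linear and
    quadratic terms cancel and only the cubic remainders survive. *)
Lemma second_order_mean4 F z : second_order F z ->
  exists C r : R, [/\ 0 <= C, 0 < r & forall s : R, 0 < s -> s < r ->
    let h := (s%:C)%C in
    cabs (F (z + h) + F (z - h) + F (z + 'i%C * h) + F (z - 'i%C * h)
          - 4%:R * F z) <= C * s ^+ 3].
Proof.
move=> [c1 [c2 [E [[C [r [r0 hE]]] hF]]]].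
have C0 : 0 <= C by rewrite (le_trans _ (hE 0 _)) ?cabs_ge0 ?cabs0.
exists (4 * C), r; split => //; first by rewrite mulr_ge0.
move=> s s0 sr; set h := (s%:C)%C; cbv zeta.
have hs : cabs h = s by rewrite cabs_real_ge0// ltW.
have ih : cabs ('i%C * h) = s by rewrite cabsM cabsi mul1r.
have B k : cabs k = s -> cabs (E k * k ^+ 3) <= C * s ^+ 3.
  move=> ks; rewrite cabsM cabsX ks ler_wpM2r ?exprn_ge0 ?(ltW s0)//.
  by apply: hE; rewrite ks.
have i2 : ('i%C : R[i]) ^+ 2 = -1 by rewrite sqr_i.
have -> : F (z + h) + F (z - h) + F (z + 'i%C * h) + F (z - 'i%C * h)
    - 4%:R * F z = E h * h ^+ 3 + E (- h) * (- h) ^+ 3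
    + E ('i%C * h) * ('i%C * h) ^+ 3 + E (- ('i%C * h)) * (- ('i%C * h)) ^+ 3.
  rewrite !hF; set a := E h * _; set b := E (- h) * _.
  set c := E ('i%C * h) * _; set d := E (- ('i%C * h)) * _.
  rewrite !sqrrN exprMn i2; ring.
rewrite (_ : 4 * C * _ = C * s ^+ 3 + C * s ^+ 3 + C * s ^+ 3 + C * s ^+ 3).
  2: ring.
do 3! (apply: le_trans (cabsD _ _) _; apply: lerD; last by apply: B; rewrite ?cabsN).
exact: B.
Qed.

End SecondOrder.

(** * Submean inequality for [|F| exp(- Re G)] *)

Section Submean.
Context {R : realType}.
Implicit Types (F G E : R[i] -> R[i]) (z w h : R[i]).

(** One step of Taylor's formula by the mean value theorem, meant to be iterated. The point [c] lies
    between 0 and [x]; the sign of [c * x] is what the iteration needs. *)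
Lemma expR_sub_poly (p : {poly R}) (x : R) : p.[0] = 1 -> exists c : R,
  [/\ 0 <= c * x, `|c| <= `|x| & expR x - p.[x] = (expR c - p^`().[c]) * x].
Proof.
move=> p0.
have D (y : R) : is_derive y 1 (fun t => expR t - p.[t]) (expR y - p^`().[y]).
  exact: is_deriveB.
have cont (a b : R) : {within `[a, b], continuous (fun t => expR t - p.[t])}.
  apply: derivable_within_continuous => y _.
  by have [] := D y.
have [x0|x0] := leP 0 x.
  have [c] := MVT_segment x0 (fun y _ => D y) (cont _ _).
  rewrite in_itv/= => /andP[c0 cx] e; exists c.
  rewrite mulr_ge0// !ger0_norm//; split => //.
  by move: e; rewrite expR0 p0 subrr !subr0.
have [c] := MVT_segment (ltW x0) (fun y _ => D y) (cont _ _).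
rewrite in_itv/= => /andP[xc c0] e; exists c.
rewrite mulr_le0// ?(ltW x0)// !ler0_norm ?(ltW x0)//; split => //.
  by rewrite lerN2.
by move: e; rewrite expR0 p0 subrr !sub0r mulrN => /oppr_inj.
Qed.

(** Two mean value steps turn the difference into [(expR d - (1 + d)) * c * t] with [c * t >= 0],
    and the first factor is nonnegative. *)
Lemma expR_ge_cubic (t : R) : 1 + t + t ^+ 2 / 2 + t ^+ 3 / 6 <= expR t.
Proof.
pose p1 : {poly R} := 1 + 'X; pose p2 := p1 + 2^-1 *: 'X^2.
pose p3 := p2 + 6^-1 *: 'X^3.
have d1 : p2^`() = p1.
  rewrite /p2 /p1 derivD derivZ derivXn derivD derivX -polyC1 derivC add0r.
  by rewrite polyC1 expr1 -scalerMnr scalerMnl -mulr_natr mulVf// scale1r.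
have d2 : p3^`() = p2.
  rewrite /p3 [in LHS]derivD d1 /p2 derivZ derivXn; congr (_ + _).
  by rewrite -scalerMnr scalerMnl -mulr_natr; congr (_ *: _); field.
have e1 x : p1.[x] = 1 + x by rewrite !hornerE.
have e2 x : p2.[x] = 1 + x + x ^+ 2 / 2 by rewrite ?/p3 ?/p2 /p1 !hornerE/= ?hornerXn; ring.
have e3 x : p3.[x] = 1 + x + x ^+ 2 / 2 + x ^+ 3 / 6.
  by rewrite ?/p3 ?/p2 /p1 !hornerE/= ?hornerXn; ring.
have [c [ct _ E3]] := @expR_sub_poly p3 t
  (etrans (e3 0) ltac:(by rewrite !expr0n/= !mul0r !addr0)).
have [d [dc _ E2]] := @expR_sub_poly p2 c
  (etrans (e2 0) ltac:(by rewrite !expr0n/= !mul0r !addr0)).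
rewrite -e3 -subr_ge0 E3 d2 E2 d1 -mulrA mulr_ge0// e1 subr_ge0.
exact: expR_ge1Dx.
Qed.

(** The quadratic Taylor polynomial stands in for the complex exponential of [- k]. With [x = Re k]
    and [n = |k|], its squared modulus is [1 - 2 x + 2 x^2 - x n^2 + n^4 / 4], which agrees with the
    cubic lower bound of [expR (- 2 x)] up to a multiple of [n^3]. *)
Lemma cabs_quadratic_le_expR (k : R[i]) : cabs k <= 2^-1 ->
  cabs (1 - k + k ^+ 2 / 2) <= expR (- complex.Re k) + 4 * cabs k ^+ 3.
Proof.
move=> k2; have k0 := cabs_ge0 k; have e0 := expR_ge0 (- complex.Re k).
have := Re_le_cabs k; have := sqr_cabs k.
have := expR_ge1Dx (- complex.Re k); have := expR_ge_cubic (- (2 * complex.Re k)).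
have -> : expR (- (2 * complex.Re k)) = expR (- complex.Re k) ^+ 2.
  by rewrite -expRM_natl; congr expR; ring.
move=> h3 h1 nxy xn.
rewrite -(@ler_pXn2r _ 2)// ?nnegrE ?cabs_ge0 ?addr_ge0 ?mulr_ge0 ?exprn_ge0//.
rewrite sqr_cabs; move: h3 h1 nxy xn; move: (cabs k) (expR _) k0 e0 k2 => n e.
case: k => x y; rewrite [complex.Re (x +i* y)%C]/= [complex.Im (x +i* y)%C]/=.
move=> n0 e0 n2 h3 h1 nxy; rewrite ler_norml => /andP[xn nx].
have -> : (1 - (x +i* y)%C + (x +i* y)%C ^+ 2 / 2) =
  ((1 - x + (x ^+ 2 - y ^+ 2) / 2) +i* (- y + x * y))%C.
  have -> : ((2 : R[i])^-1 = ((2^-1)%:C)%C) by rewrite fmorphV rmorph_nat.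
  by apply/eqP; rewrite eq_complex/= expr2/=; apply/andP; split; apply/eqP; field.
change ((1 - x + (x ^+ 2 - y ^+ 2) / 2) ^+ 2 + (- y + x * y) ^+ 2
  <= (e + 4 * n ^+ 3) ^+ 2).
have -> : (1 - x + (x ^+ 2 - y ^+ 2) / 2) ^+ 2 + (- y + x * y) ^+ 2 =
  1 - 2 * x + 2 * x ^+ 2 - x * n ^+ 2 + n ^+ 4 / 4.
  have -> : n ^+ 4 = (n ^+ 2) ^+ 2 by rewrite -exprM.
  by rewrite nxy; field.
have e2 : 2^-1 <= e by lra.
have n3 : 0 <= n ^+ 3 by rewrite exprn_ge0.
have x3 : x ^+ 3 <= n ^+ 3.
  have [x0|x0] := leP 0 x; first by rewrite lerXn2r.
  rewrite (le_trans _ n3)// exprS mulr_le0_ge0 ?(ltW x0)// sqr_ge0//.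
have n4 : n ^+ 4 <= n ^+ 3 / 2 by rewrite exprS mulrC ler_wpM2l.
have xn3 : - x * n ^+ 2 <= n ^+ 3.
  by rewrite [in leRHS]exprS ler_wpM2r ?sqr_ge0//; lra.
have en : n ^+ 3 <= 2 * (e * n ^+ 3).
  by rewrite mulrA ler_peMl//; lra.
have n6 : 0 <= n ^+ 3 * n ^+ 3 by rewrite mulr_ge0.
have -> : (e + 4 * n ^+ 3) ^+ 2 = e ^+ 2 + 8 * (e * n ^+ 3) + 16 * (n ^+ 3 * n ^+ 3).
  by ring.
have eqq : 1 + - (2 * x) + (- (2 * x)) ^+ 2 / 2 + (- (2 * x)) ^+ 3 / 6 =
   1 - 2 * x + 2 * x ^+ 2 - 4 / 3 * x ^+ 3 by field.
rewrite eqq in h3.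
lra.
Qed.

(** With [D = G - G z], the function [Q = F * (1 - D + D^2 / 2)] has a second-order expansion, so
    its four-point mean is [Q z = F z] up to [O(s^3)]. Up to the factor [e0], [|Q|] equals [Phi] at
    [z] and exceeds it by at most [O(s^3)] at the four points. *)
Lemma second_order_submean F G z : second_order F z -> second_order G z ->
  let Phi := fun w => cabs (F w) * expR (- complex.Re (G w)) in
  exists C r : R, 0 < r /\ forall s : R, 0 < s -> s < r ->
    let h := (s%:C)%C in
    4 * Phi z - C * s ^+ 3
      <= Phi (z + h) + Phi (z - h) + Phi (z + 'i%C * h) + Phi (z - 'i%C * h).
Proof.
move=> hF hG Phi.
pose D w := G w - G z.
have hD : second_order D z by apply: second_orderD => //; exact: second_order_cst.
pose Q w := F w * (1 + (-1) * D w + D w ^+ 2 * 2^-1).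
have hQ : second_order Q z.
  apply: second_orderM => //; apply: second_orderD.
    apply: second_orderD; first exact: second_order_cst.
    by apply: second_orderM => //; exact: second_order_cst.
  by apply: second_orderM; [exact: second_orderX|exact: second_order_cst].
have [C1 [r1 [C10 r10 mean]]] := second_order_mean4 hQ.
have [L [r2 [L0 r20 lip]]] := second_order_lipschitz hG.
have [M [r3 [M0 r30 lipF]]] := second_order_lipschitz hF.
(* For [s < r4] the Lipschitz bound gives [|D| <= 1/2], as the quadratic estimate requires. *)
pose r4 := (2 * (L + 1))^-1; pose e0 := expR (- complex.Re (G z)).
have r40 : 0 < r4 by rewrite invr_gt0 mulr_gt0// ltr_wpDl.
pose B := cabs (F z) + M * r3.
have B0 : 0 <= B by rewrite addr_ge0 ?cabs_ge0// mulr_ge0// ltW.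
(* [C1] is the error of the mean of [Q]; each of the four points costs [B * 4 * |D|^3] with
   [|F| <= B] and [|D| <= L s]. *)
exists (e0 * (C1 + 4 * (B * (4 * L ^+ 3)))), (Num.min (Num.min r1 r2) (Num.min r3 r4)).
split; first by rewrite !lt_min r10 r20 r30.
move=> s s0; rewrite !lt_min => /andP[/andP[sr1 sr2] /andP[sr3 sr4]].
set h := (s%:C)%C; cbv zeta.
have hs : cabs h = s by rewrite cabs_real_ge0// ltW.
have ih : cabs ('i%C * h) = s by rewrite cabsM cabsi mul1r.
have e00 : 0 <= e0 by exact: expR_ge0.
have key k : cabs k = s ->
    e0 * (cabs (Q (z + k)) - B * (4 * L ^+ 3) * s ^+ 3) <= Phi (z + k).
  move=> ks.
  have Dk : cabs (D (z + k)) <= L * s by rewrite -ks lip// ks.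
  have D2 : cabs (D (z + k)) <= 2^-1.
    rewrite (le_trans Dk)//.
    have : (L + 1) * s <= (L + 1) * r4 by rewrite ler_wpM2l ?(ltW sr4)// addr_ge0.
    rewrite /r4 invfM mulrCA divff ?gt_eqF ?ltr_wpDl// mulr1.
    by apply: le_trans; rewrite ler_wpM2r ?(ltW s0)// lerDl.
  have FB : cabs (F (z + k)) <= B.
    rewrite -[F (z + k)](subrK (F z)) (le_trans (cabsD _ _))// addrC lerD2l.
    by rewrite (le_trans (lipF _ _)) ?ks// ler_wpM2l// ltW.
  have -> : Phi (z + k) = e0 * (cabs (F (z + k)) * expR (- complex.Re (D (z + k)))).
    rewrite mulrCA -expRD; congr (_ * expR _).
    by rewrite /D; case: (G (z + k)) (G z) => [a b] [c d]/=; ring.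
  rewrite ler_wpM2l// /Q cabsM lerBlDr.
  have := cabs_quadratic_le_expR (k := D (z + k)) D2.
  rewrite (_ : 1 - D (z + k) + D (z + k) ^+ 2 / 2 =
    1 + (-1) * D (z + k) + D (z + k) ^+ 2 * 2^-1); last by rewrite mulN1r.
  move=> /(ler_wpM2l (cabs_ge0 (F (z + k)))) /le_trans; apply.
  rewrite mulrDr lerD2l -mulrA.
  rewrite (le_trans (_ : _ <= B * (4 * cabs (D (z + k)) ^+ 3)))//.
    by rewrite ler_wpM2r// mulr_ge0// exprn_ge0// cabs_ge0.
  rewrite ler_wpM2l// -mulrA ler_wpM2l// -exprMn lerXn2r// ?nnegrE ?cabs_ge0//.
  by rewrite mulr_ge0// ltW.
have := mean s s0 sr1; rewrite -/h; cbv zeta.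
have -> : Q z = F z by rewrite /Q /D subrr mulr0 expr0n/= mul0r !addr0 mulr1.
set S := Q _ + _ + _ + _ => hS.
have h4 : 4 * cabs (F z) <= cabs S + C1 * s ^+ 3.
  have -> : 4 * cabs (F z) = cabs (4 * F z).
    by rewrite cabsM cabs_nat.
  rewrite -lerBlDl (le_trans (cabsB_ge _ _))// cabsBC.
  exact: hS.
have hS4 : cabs S <= cabs (Q (z + h)) + cabs (Q (z - h)) + cabs (Q (z + 'i%C * h))
    + cabs (Q (z - 'i%C * h)).
  rewrite /S; do 2! (apply: le_trans (cabsD _ _) _; rewrite lerD2r).
  exact: cabsD.
have k1 := key h hs; have k2 := key (- h) ltac:(by rewrite cabsN).
have k3 := key ('i%C * h) ih.
have k4 := key (- ('i%C * h)) ltac:(by rewrite cabsN).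
have PhiE : Phi z = e0 * cabs (F z) by rewrite mulrC.
have h5 : e0 * (4 * cabs (F z)) <= e0 * (cabs (Q (z + h)) + cabs (Q (z - h))
    + cabs (Q (z + 'i%C * h)) + cabs (Q (z - 'i%C * h)) + C1 * s ^+ 3).
  by rewrite ler_wpM2l// (le_trans h4)// lerD2r.
rewrite PhiE; lra.
Qed.

End Submean.

(** * Maximum principle *)

Section MaximumPrinciple.
Context {R : realType}.
Implicit Types (F G : R[i] -> R[i]) (Phi : R[i] -> R) (X : set R[i]).
Implicit Types z w h : R[i].

Definition ccontinuous_at Phi z := forall e : R, 0 < e ->
  exists2 r : R, 0 < r & forall h, cabs h < r -> `|Phi (z + h) - Phi z| < e.

Definition cclosed X := forall z, ~ X z ->
  exists2 r : R, 0 < r & forall h, cabs h < r -> ~ X (z + h).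

Lemma cabs_prod_ball (x y x' y' e : R) :
  `|x - x'| < e / 2 -> `|y - y'| < e / 2 ->
  cabs ((x' - x) +i* (y' - y))%C < e.
Proof.
move=> hx hy; apply: le_lt_trans (cabs_le_ReIm _) _ => /=.
by rewrite (splitr e) ltrD// distrC.
Qed.

(** The extreme value theorem is transported from [R * R], where the image of [X] is a closed subset
    of the square of half-side [rho]. *)
Lemma ccompact_max X Phi (rho : R) z0 : X z0 ->
  (forall z, X z -> cabs z <= rho) -> cclosed X ->
  (forall z, X z -> ccontinuous_at Phi z) ->
  exists2 m, X m & forall z, X z -> Phi z <= Phi m.
Proof.
move=> Xz0 bX cX cPhi.
pose c (u : R * R) : R[i] := (u.1 +i* u.2)%C.
have cE z : c (complex.Re z, complex.Im z) = z by case: z.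
pose A : set (R * R) := [set u | X (c u)].
have near_c (u : R * R) (P : R[i] -> Prop) (r : R) : 0 < r ->
    (forall h, cabs h < r -> P (c u + h)) -> \forall v \near u, P (c v).
  move=> r0 hP; apply/nbhs_ballP; exists (r / 2); first by rewrite /= divr_gt0.
  move=> [x' y'] [/= bx by_]; have <- : c u + (c (x', y') - c u) = c (x', y').
    by rewrite addrC subrK.
  by apply: hP; apply: cabs_prod_ball.
have clA : closed A.
  rewrite -openC openE => u /= nXu.
  have [r r0 hr] := cX _ nXu.
  exact: (near_c u (fun z => ~ X z) r).
have cA : compact A.
  apply: (subclosed_compact clA
    (compact_setX (@segment_compact R (- rho) rho) (@segment_compact R (- rho) rho))).
  move=> u /= /bX hu; have := le_trans (Re_le_cabs _) hu.
  have := le_trans (Im_le_cabs _) hu.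
  by rewrite !ler_norml => h1 h2; split; rewrite /= in_itv/=.
have A0 : A !=set0 by exists (complex.Re z0, complex.Im z0); rewrite /A/= cE.
have contA : {within A, continuous (Phi \o c)}.
  apply: continuous_in_subspaceT => u; rewrite inE => /= Xu.
  apply/cvgrPdist_lt => e e0.
  have [r r0 hr] := cPhi _ Xu _ e0.
  by apply: (near_c u (fun z => `|Phi (c u) - Phi z| < e) r) => // h /hr; rewrite distrC.
have [m mA mmax] := compact_EVT_max A0 cA contA.
exists (c m); first by rewrite inE in mA.
move=> z Xz; rewrite -(cE z); apply: (mmax (complex.Re z, complex.Im z)).
by rewrite inE /A/= cE.
Qed.

Lemma ccontinuous_at_sqr z : ccontinuous_at (fun w => cabs w ^+ 2) z.
Proof.
move=> e e0; pose M := 2 * cabs z + 1.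
have M0 : 0 < M by rewrite ltr_wpDl// mulr_ge0// cabs_ge0.
exists (Num.min 1 (e / M)); first by rewrite lt_min ltr01 divr_gt0.
move=> h; rewrite lt_min => /andP[h1 he].
rewrite subr_sqr normrM.
have a1 : `|cabs (z + h) - cabs z| <= cabs h.
  have := cabsD z h; have := cabsD (z + h) (- h).
  rewrite addrK cabsN ler_norml => k1 k2; apply/andP; split; lra.
have a2 : `|cabs (z + h) + cabs z| <= M.
  rewrite ger0_norm ?addr_ge0 ?cabs_ge0// /M.
  have := cabsD z h; lra.
rewrite (le_lt_trans (ler_pM _ _ a1 a2))//.
by rewrite -ltr_pdivlMr.
Qed.

(** The points with [Phi z <= 1] play the role of the boundary. Elsewhere the strictly subharmonic
    perturbation [Phi + d |z|^2] cannot have a maximum: the four-point sum of [|z|^2] gains [4 s^2],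
    which beats the error [C s^3] for small [s]. *)
Lemma maximum_principle X Phi (rho : R) :
  (forall z, X z -> cabs z <= rho) -> cclosed X ->
  (forall z, X z -> ccontinuous_at Phi z) ->
  (forall z, X z -> Phi z <= 1 \/ exists C r : R, 0 < r /\
     forall s : R, 0 < s -> s < r -> let h := (s%:C)%C in
       [/\ X (z + h), X (z - h), X (z + 'i%C * h), X (z - 'i%C * h) &
       4 * Phi z - C * s ^+ 3
       <= Phi (z + h) + Phi (z - h) + Phi (z + 'i%C * h) + Phi (z - 'i%C * h)]) ->
  forall z, X z -> Phi z <= 1.
Proof.
move=> bX cX cPhi bd z Xz.
have rho0 : 0 <= rho by rewrite (le_trans (cabs_ge0 z))// bX.
apply/ler_addgt0Pl => e e0.
(* With this choice the perturbation costs at most [e] on the disk of radius [rho]. *)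
pose d := e / (rho ^+ 2 + 1).
have d0 : 0 < d by rewrite divr_gt0// ltr_wpDl// sqr_ge0.
pose Psi w := Phi w + d * cabs w ^+ 2.
have cPsi w : X w -> ccontinuous_at Psi w.
  move=> Xw t t0.
  have t2 : 0 < t / 2 by rewrite divr_gt0.
  have [r1 r10 h1] := cPhi w Xw _ t2.
  have [r2 r20 h2] := ccontinuous_at_sqr w (divr_gt0 t2 d0).
  exists (Num.min r1 r2); first by rewrite lt_min r10.
  move=> h; rewrite lt_min => /andP[/h1 hr1 /h2 hr2].
  have -> : Psi (w + h) - Psi w = (Phi (w + h) - Phi w)
      + d * (cabs (w + h) ^+ 2 - cabs w ^+ 2) by rewrite /Psi; ring.
  rewrite (le_lt_trans (ler_normD _ _))// (splitr t) ltrD//.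
  by rewrite normrM gtr0_norm// mulrC -ltr_pdivlMr.
have [m Xm mmax] := ccompact_max Xz bX cX cPsi.
have de w : X w -> d * cabs w ^+ 2 <= e.
  move=> Xw; rewrite /d mulrAC ler_pdivrMr ?ltr_wpDl ?sqr_ge0//.
  rewrite ler_wpM2l ?(ltW e0)// (le_trans (_ : _ <= rho ^+ 2)) ?lerDl//.
  by rewrite lerXn2r ?nnegrE ?cabs_ge0// bX.
have [Pm|[C [r [r0 hr]]]] := bd m Xm.
  have := mmax z Xz; have := de m Xm; rewrite /Psi => h1 h2.
  have : 0 <= d * cabs z ^+ 2 by rewrite mulr_ge0 ?(ltW d0)// sqr_ge0.
  lra.
exfalso.
(* The second bound makes [C s^3 <= d s^2], less than the gain [4 d s^2]. *)
pose s := Num.min (r / 2) (d / (`|C| + 1)).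
have C1 : 0 < `|C| + 1 by rewrite ltr_wpDl.
have s0 : 0 < s by rewrite lt_min; apply/andP; split; apply: divr_gt0.
have sr : s < r by rewrite gt_min ltr_pdivrMr// ltr_pMr// ltr1n.
have [X1 X2 X3 X4] := hr s s0 sr.
have := mmax _ X1; have := mmax _ X2; have := mmax _ X3; have := mmax _ X4.
rewrite /Psi.
set h := (s%:C)%C.
have sq : cabs (m + h) ^+ 2 + cabs (m - h) ^+ 2 + cabs (m + 'i%C * h) ^+ 2
   + cabs (m - 'i%C * h) ^+ 2 = 4 * cabs m ^+ 2 + 4 * s ^+ 2.
  by rewrite !sqr_cabs /h; case: (m) => a b /=; ring.
have Cs : C * s ^+ 3 <= d * s ^+ 2.
  rewrite exprS mulrA ler_wpM2r ?sqr_ge0//.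
  rewrite (le_trans (ler_norm _))// normrM (gtr0_norm s0).
  rewrite (le_trans (_ : _ <= (`|C| + 1) * s)) ?ler_wpM2r ?(ltW s0) ?lerDl//.
  by rewrite mulrC -ler_pdivlMr// ge_min lexx orbT.
have ds : 0 < d * s ^+ 2 by rewrite mulr_gt0// exprn_gt0.
move: sq; set x1 := cabs (m + h) ^+ 2; set x2 := cabs (m - h) ^+ 2.
set x3 := cabs (m + 'i%C * h) ^+ 2; set x4 := cabs (m - 'i%C * h) ^+ 2 => sq.
have : d * x1 + d * x2 + d * x3 + d * x4 = 4 * (d * cabs m ^+ 2) + 4 * (d * s ^+ 2).
  rewrite -!mulrDr sq; ring.
move=> dsq; lra.
Qed.

End MaximumPrinciple.

(** * Power series have second-order expansions *)

Section PowerSeries.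
Context {R : realType}.
Implicit Types (u v a : nat -> R[i]) (l z w h : R[i]).

Lemma ccvgD u v l l' : ccvg u l -> ccvg v l' ->
  ccvg (fun n => u n + v n) (l + l').
Proof.
move=> hu hv e e0; have e2 : 0 < e / 2 by rewrite divr_gt0.
have [N1 h1] := hu _ e2; have [N2 h2] := hv _ e2.
exists (maxn N1 N2) => n; rewrite geq_max => /andP[n1 n2].
rewrite opprD addrACA (le_lt_trans (cabsD _ _))// (splitr e) ltrD ?h1 ?h2//.
Qed.

Lemma ccvgMl u l c : ccvg u l -> ccvg (fun n => c * u n) (c * l).
Proof.
move=> hu e e0; have c1 : 0 < cabs c + 1 by rewrite ltr_wpDl ?cabs_ge0.
have [N hN] := hu (e / (cabs c + 1)) (divr_gt0 e0 c1).
exists N => n /hN; rewrite -mulrBr cabsM ltr_pdivlMr// mulrC => h.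
by rewrite (le_lt_trans _ h)// ler_wpM2r ?cabs_ge0// lerDl.
Qed.

Lemma ccvg_cabs_le u l (B : R) : ccvg u l -> (forall n, cabs (u n) <= B) ->
  cabs l <= B.
Proof.
move=> hu hB; apply/ler_addgt0Pl => e e0.
have [N hN] := hu e e0; have := hN N (leqnn N); have := hB N.
have := cabsD (u N) (l - u N); rewrite addrCA subrr addr0 cabsBC; lra.
Qed.

Lemma cvg_ccvg (x y : nat -> R) (lx ly : R) :
  x @ \oo --> lx -> y @ \oo --> ly ->
  ccvg (fun n => (x n +i* y n)%C) (lx +i* ly)%C.
Proof.
move=> /cvgrPdist_lt hx /cvgrPdist_lt hy e e0.
have e2 : 0 < e / 2 by rewrite divr_gt0.
have [N1 _ h1] := hx _ e2; have [N2 _ h2] := hy _ e2.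
exists (maxn N1 N2) => n; rewrite geq_max => /andP[n1 n2].
by apply: cabs_prod_ball; [exact: h1|exact: h2].
Qed.

Lemma ccvg_geometric u (A t : R) : 0 <= t -> t < 1 ->
  (forall n, cabs (u n) <= A * t ^+ n) ->
  exists l, ccvg (fun N => \sum_(n < N) u n) l.
Proof.
move=> t0 t1 hu.
have cvg_part (x : nat -> R) : (forall n, `|x n| <= cabs (u n)) ->
    cvgn (series x).
  move=> hx; apply: normed_cvg.
  apply: (@series_le_cvg _ _ (geometric A t)) => //.
  - by move=> n /=; exact: normr_ge0.
  - by move=> n; rewrite /= (le_trans _ (hu n))// cabs_ge0.
  - by move=> n; apply: le_trans (hx n) _; exact: hu.
  - by apply: is_cvg_geometric_series; rewrite ger0_norm.
have cx := cvg_part _ (fun n => Re_le_cabs (u n)).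
have cy := cvg_part _ (fun n => Im_le_cabs (u n)).
exists (limn (series (fun n => complex.Re (u n)))
   +i* limn (series (fun n => complex.Im (u n))))%C.
have := cvg_ccvg cx cy; congr ccvg; apply/funext => N.
rewrite /series/= !big_mkord.
elim: N => [|N IH]; first by rewrite !big_ord0.
by rewrite !big_ord_recr/= -IH; case: (u N).
Qed.

Lemma geometric_sum_le (t : R) N : 0 <= t -> t < 1 ->
  \sum_(n < N) t ^+ n <= (1 - t)^-1.
Proof.
move=> t0 t1; have t1' : 0 < 1 - t by rewrite subr_gt0.
rewrite -div1r ler_pdivlMr// mulrC.
have := subrX1 t N; have := exprn_ge0 N t0; nra.
Qed.

Lemma exprD_expand3 (K : comNzRingType) (x y : K) n :
  (x + y) ^+ n = x ^+ n + (n%:R * x ^+ n.-1 * y + ('C(n, 2)%:R * x ^+ (n - 2) * y ^+ 2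
    + \sum_(k < n) 'C(n, 3 + k)%:R * x ^+ (n - (3 + k)) * y ^+ (3 + k))).
Proof.
(* The binomial sum is prolonged by two terms, which vanish because ['C(n, k) = 0] for [k > n].
   Three terms can then be split off for every [n], even [n < 2]. *)
pose F k := 'C(n, k)%:R * x ^+ (n - k) * y ^+ k.
transitivity (\sum_(k < n.+3) F k).
  rewrite exprDn [RHS]big_ord_recr [X in _ = X + _]big_ord_recr/= /F !bin_small//.
  rewrite !mul0r !addr0.
  by apply: eq_bigr => k _; rewrite -mulr_natl mulrA.
rewrite !big_ord_recl [in LHS]/F.
by rewrite !lift0 bin0 bin1 subn0 subn1 !mul1r expr0 mulr1 expr1.
Qed.

(** Every remaining term contains [h] to a power at least 3, and
    [|h|^(3+k) <= (|h| / rho)^3 rho^(3+k)]. What is left is the corresponding part of the expansion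
    of [(|z| + rho)^n]. *)
Lemma exprD_remainder3 (z h : R[i]) (rho : R) n : 0 < rho -> cabs h <= rho ->
  cabs ((z + h) ^+ n - z ^+ n - (n%:R * z ^+ n.-1) * h
        - ('C(n, 2)%:R * z ^+ (n - 2)) * h ^+ 2)
  <= (cabs h / rho) ^+ 3 * (cabs z + rho) ^+ n.
Proof.
move=> rho0 hrho.
rewrite !exprD_expand3.
set S := (X in cabs (_ + (_ + (_ + X)) - _ - _ - _)).
set T := (X in _ <= _ * (_ + (_ + (_ + X)))).
have -> : (z ^+ n + (n%:R * z ^+ n.-1 * h + ('C(n, 2)%:R * z ^+ (n - 2) * h ^+ 2 + S))
   - z ^+ n - n%:R * z ^+ n.-1 * h - 'C(n, 2)%:R * z ^+ (n - 2) * h ^+ 2) = S by ring.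
have ST : cabs S <= (cabs h / rho) ^+ 3 * T.
  rewrite (le_trans (cabs_sum _ _ _))// /T mulr_sumr; apply: ler_sum => k _.
  rewrite 2!cabsM cabs_nat !cabsX [leRHS]mulrCA.
  rewrite ler_wpM2l ?mulr_ge0 ?exprn_ge0 ?cabs_ge0//.
  rewrite [leLHS]exprD [in leRHS]exprD mulrA -exprMn divfK ?gt_eqF//.
  rewrite ler_wpM2l ?exprn_ge0 ?cabs_ge0//.
  by rewrite lerXn2r// ?nnegrE ?cabs_ge0// ltW.
rewrite (le_trans ST)// ler_wpM2l ?exprn_ge0 ?divr_ge0 ?cabs_ge0 ?(ltW rho0)//.
have c0 := cabs_ge0 z; have r0 := ltW rho0.
rewrite -[leLHS]add0r lerD ?exprn_ge0// -[leLHS]add0r lerD//.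
  by rewrite !mulr_ge0// exprn_ge0.
by rewrite -[leLHS]add0r lerD// !mulr_ge0// exprn_ge0.
Qed.

(** From some index on, consecutive partial sums are both within 1 of the limit, so the terms have
    modulus at most 2; the sum over the earlier terms covers the rest. *)
Lemma coef_geometric_bound a z : (exists l, ccvg (fun N => \sum_(n < N) a n * z ^+ n) l) ->
  exists2 A : R, 0 <= A & forall n, cabs (a n) * cabs z ^+ n <= A.
Proof.
move=> [l hl].
have [N hN] := hl 1 ltr01.
exists (2 + \sum_(n < N) cabs (a n) * cabs z ^+ n).
  by rewrite addr_ge0// sumr_ge0// => n _; rewrite mulr_ge0 ?exprn_ge0 ?cabs_ge0.
move=> n; have [nN|Nn] := ltnP n N.
  rewrite (bigD1 (Ordinal nN))//= addrCA lerDl addr_ge0// sumr_ge0// => i _.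
  by rewrite mulr_ge0 ?exprn_ge0 ?cabs_ge0.
have s0 : 0 <= \sum_(n < N) cabs (a n) * cabs z ^+ n.
  by rewrite sumr_ge0// => i _; rewrite mulr_ge0 ?exprn_ge0 ?cabs_ge0.
have h1 := hN n Nn; have := hN n.+1 (leqW Nn); rewrite big_ord_recr/=.
move: h1; set S := \sum_(i < n) _ => h1 h2.
rewrite -cabsX -cabsM (_ : a n * z ^+ n = (S + a n * z ^+ n - l) - (S - l)).
  2: ring.
rewrite (le_trans (cabsD _ _))// cabsN; lra.
Qed.

(** The powers [(z + h)^n] are expanded term by term. The coefficients of [h] and [h^2] are sums of
    convergent series, and the cubic remainders are dominated by a geometric series uniformly in
    [h]. *)
Lemma analytic_second_order (f : R[i] -> R[i]) z : analytic_on_disk f ->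
  cabs z < 1 -> second_order f z.
Proof.
move=> [a ha] z1; have z0 := cabs_ge0 z.
(* The radii [|z| < |z| + rho < sig < 1] are equally spaced: convergence at [sig] bounds the
   coefficients, and [h] of size up to [rho] leaves the geometric ratio
   [t = (|z| + rho) / sig < 1]. *)
pose rho := (1 - cabs z) / 3; pose sig := cabs z + 2 * rho.
have rho0 : 0 < rho by rewrite divr_gt0// subr_gt0.
have sig1 : sig < 1 by rewrite /sig /rho; lra.
have sig0 : 0 < sig by rewrite ltr_wpDl// mulr_gt0.
pose t := (cabs z + rho) / sig.
have rho0' := ltW rho0; have sig0' := ltW sig0.
have t0 : 0 <= t by apply: divr_ge0 => //; apply: addr_ge0.
have t1 : t < 1 by rewrite /t ltr_pdivrMr// mul1r /sig; lra.
have [A A0 hA] : exists2 A : R, 0 <= A &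
    forall n, cabs (a n) * (cabs z + rho) ^+ n <= A * t ^+ n.
  have [|A A0 hA] := @coef_geometric_bound a (sig%:C)%C.
    by exists (f (sig%:C)%C); apply: ha; rewrite cabs_real_ge0 ?ltW.
  exists A => // n; rewrite /t expr_div_n mulrA.
  rewrite ler_pdivlMr ?exprn_gt0// mulrAC ler_wpM2r ?exprn_ge0 ?addr_ge0//.
  by have := hA n; rewrite cabs_real_ge0// ltW.
(* The [n]-th term times [rho^k] is bounded by one term of the binomial expansion of
   [(|z| + rho)^n]. *)
have coef k : exists l, ccvg (fun N => \sum_(n < N) a n * ('C(n, k)%:R * z ^+ (n - k))) l.
  refine (@ccvg_geometric (fun n => a n * ('C(n, k)%:R * z ^+ (n - k)))
    (A / rho ^+ k) t t0 t1 _) => // n.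
  rewrite !cabsM cabs_nat cabsX mulrAC ler_pdivlMr ?exprn_gt0//.
  apply: le_trans (hA n); rewrite -mulrA ler_wpM2l ?cabs_ge0//.
  have [kn|nk] := leqP k n; last first.
    by rewrite bin_small// !mul0r exprn_ge0// addr_ge0// ltW.
  rewrite exprDn (bigD1 (Ordinal (kn : (k < n.+1)%N)))//=.
  rewrite -[X in _ <= X + _]mulr_natl mulrA lerDl.
  rewrite sumr_ge0// => i _.
  by rewrite mulrn_wge0// mulr_ge0// exprn_ge0// ltW.
have [l1 h1] := coef 1%N; have [l2 h2] := coef 2%N.
exists l1, l2, (fun h => (f (z + h) - f z - l1 * h - l2 * h ^+ 2) / h ^+ 3).
split; last first.
  move=> h; have [->|h0] := eqVneq h 0; first by rewrite addr0; ring.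
  by rewrite divfK ?expf_neq0//; ring.
exists (A / (1 - t) / rho ^+ 3), rho; split => // h hr.
have [->|h0] := eqVneq h 0.
  rewrite addr0 subrr mulr0 [0 ^+ 2]expr0n mulr0 !subr0 mul0r cabs0.
  by rewrite !divr_ge0 ?subr_ge0 ?exprn_ge0 ?(ltW t1).
rewrite cabsM cabsV cabsX ler_pdivrMr ?exprn_gt0 ?cabs_gt0//.
have zh : cabs (z + h) < 1.
  by rewrite (le_lt_trans (cabsD _ _))//; move: hr; rewrite /rho; lra.
have lim := ccvgD (ccvgD (ccvgD (ha _ zh) (ccvgMl (-1) (ha _ z1)))
  (ccvgMl (- h) h1)) (ccvgMl (- h ^+ 2) h2).
rewrite (_ : f (z + h) - f z - l1 * h - l2 * h ^+ 2 =
  f (z + h) + -1 * f z + (- h) * l1 + (- h ^+ 2) * l2); last by ring.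
apply: (ccvg_cabs_le lim) => N.
rewrite !mulr_sumr -!big_split/=.
apply: le_trans (cabs_sum _ _ _) _.
apply: (@le_trans _ _ (\sum_(n < N) (cabs h / rho) ^+ 3 * A * t ^+ n)).
  apply: ler_sum => n _.
  rewrite (_ : _ + _ = a n * ((z + h) ^+ n - z ^+ n - (n%:R * z ^+ n.-1) * h
        - ('C(n, 2)%:R * z ^+ (n - 2)) * h ^+ 2)); last first.
    by rewrite bin1 subn1; ring.
  rewrite cabsM (le_trans (ler_wpM2l (cabs_ge0 _) (exprD_remainder3 _ n rho0 (ltW hr))))//.
  by rewrite mulrCA -mulrA ler_wpM2l// exprn_ge0// divr_ge0 ?cabs_ge0// ltW.
rewrite -mulr_sumr expr_div_n.
have -> : A / (1 - t) / rho ^+ 3 * cabs h ^+ 3 = cabs h ^+ 3 / rho ^+ 3 * A * (1 - t)^-1.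
  by ring.
rewrite ler_wpM2l ?geometric_sum_le//.
by rewrite mulr_ge0// divr_ge0 ?exprn_ge0 ?cabs_ge0// ltW.
Qed.

End PowerSeries.

(** * A Jensen inequality on subregions of the disk *)

Section Jensen.
Context {R : realType}.
Implicit Types (f g F G : R[i] -> R[i]) (Phi : R[i] -> R) (X : set R[i]).
Implicit Types (z w h : R[i]) (L : seq R[i]).

Lemma ccontinuous_at_cabs F z : second_order F z ->
  ccontinuous_at (fun w => cabs (F w)) z.
Proof.
move=> /second_order_continuous hF e /hF[r r0 hr]; exists r => // h /hr.
apply: le_lt_trans; have := cabsB_ge (F (z + h)) (F z).
have := cabsB_ge (F z) (F (z + h)); rewrite [cabs (F z - _)]cabsBC ler_norml.
move=> h1 h2; apply/andP; split; lra.
Qed.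

Lemma ccontinuous_at_Re F z : second_order F z ->
  ccontinuous_at (fun w => complex.Re (F w)) z.
Proof.
move=> /second_order_continuous hF e /hF[r r0 hr]; exists r => // h /hr.
apply: le_lt_trans; rewrite (le_trans _ (Re_le_cabs _))//.
by case: (F (z + h)) (F z) => [a b] [c d].
Qed.

Lemma ccontinuous_at_comp (phi : R -> R) Phi z : continuous phi ->
  ccontinuous_at Phi z -> ccontinuous_at (fun w => phi (Phi w)) z.
Proof.
move=> cphi cPhi e e0.
have /cvgrPdist_lt/(_ _ e0)/nbhs_ballP[d /= d0 hd] := cphi (Phi z).
have [r r0 hr] := cPhi d d0; exists r => // h /hr hh.
by rewrite distrC; apply: hd; rewrite /ball/= distrC.
Qed.

Lemma ccontinuous_atM Phi1 Phi2 z : ccontinuous_at Phi1 z ->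
  ccontinuous_at Phi2 z -> ccontinuous_at (fun w => Phi1 w * Phi2 w) z.
Proof.
move=> c1 c2 e e0.
have a0 : 0 < `|Phi1 z| + 1 by rewrite ltr_wpDl.
have b0 : 0 < `|Phi2 z| + 1 by rewrite ltr_wpDl.
have e2 : 0 < e / 2 by rewrite divr_gt0.
have [r1 r10 h1] := c1 (Num.min 1 (e / 2 / (`|Phi2 z| + 1)))
  ltac:(by rewrite lt_min ltr01/= divr_gt0).
have [r2 r20 h2] := c2 (e / 2 / (`|Phi1 z| + 1)) (divr_gt0 e2 a0).
exists (Num.min r1 r2); first by rewrite lt_min r10.
move=> h; rewrite lt_min => /andP[/h1 + /h2]; rewrite lt_min => /andP[u1 u2] u3.
set a := Phi1 (z + h) in u1 u2 *; set b := Phi2 (z + h) in u3 *.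
have -> : a * b - Phi1 z * Phi2 z = a * (b - Phi2 z) + (a - Phi1 z) * Phi2 z by ring.
rewrite (le_lt_trans (ler_normD _ _))// (splitr e) ltrD// normrM.
  have aa : `|a| <= `|Phi1 z| + 1.
    by have := ler_normD (Phi1 z) (a - Phi1 z); rewrite addrCA subrr addr0; lra.
  by rewrite (le_lt_trans (ler_wpM2r _ aa))// mulrC -ltr_pdivlMr.
rewrite (le_lt_trans (_ : _ <= `|a - Phi1 z| * (`|Phi2 z| + 1))) -?ltr_pdivlMr//.
by rewrite ler_wpM2l// lerDl.
Qed.

Lemma prodB_eq0 L z : (\prod_(y <- L) (z - y) == 0) = (z \in L).
Proof.
rewrite prodf_seq_eq0; apply/hasP/idP => [[y yL]|zL]; last by exists z; rewrite //= subrr.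
by rewrite /= subr_eq0 => /eqP ->.
Qed.

Lemma prodB_count_at L w z : \prod_(y <- L) (z - y) =
  (z - w) ^+ count_mem w L * \prod_(y <- L | y != w) (z - y).
Proof.
elim: L => [|y L IH]; first by rewrite !big_nil mul1r.
rewrite !big_cons/=; have [->|yz] := eqVneq y w; last by rewrite IH mulrCA.
by rewrite IH exprS mulrA.
Qed.

Lemma notin_near L w : exists2 r : R, 0 < r &
  forall h, h != 0 -> cabs h < r -> w + h \notin L.
Proof.
elim: L => [|y L [r r0 hr]]; first by exists 1.
have [->|yw] := eqVneq y w.
  exists r => // h h0 /(hr h h0); rewrite inE negb_or => ->.
  by rewrite -subr_eq0 addrAC subrr add0r h0.
exists (Num.min r (cabs (y - w))).
  by rewrite lt_min r0 cabs_gt0 subr_eq0.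
move=> h h0; rewrite lt_min => /andP[/(hr h h0) hL hy].
rewrite inE negb_or hL andbT; apply: contraTneq hy => <-.
by rewrite addrAC subrr add0r ltxx.
Qed.

(** Each zero comes with a factorization of its own, valid on the whole disk. Dividing it by the
    remaining factors gives a quotient [e w] that is regular at [w]; all these quotients agree off
    [L], so [z |-> e z z] coincides with [e w] near [w]. *)
Lemma zeros_factor f L : analytic_on_disk f ->
  (forall w, w \in L -> cabs w < 1) ->
  (forall w, w \in L -> exists2 n, (count_mem w L <= n)%N & vanishes_to f w n) ->
  exists g, (forall z, cabs z < 1 -> second_order g z) /\
    forall z, cabs z < 1 -> f z = \prod_(y <- L) (z - y) * g z.
Proof.
move=> af L1 hL.
have dec w : exists ng : nat * (R[i] -> R[i]), (count_mem w L <= ng.1)%N /\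
    (cabs w < 1 -> second_order ng.2 w) /\
    forall z, cabs z < 1 -> f z = (z - w) ^+ ng.1 * ng.2 z.
  have [wL|wL] := boolP (w \in L).
    have [n cn [g [ag fg]]] := hL w wL.
    by exists (n, g); split => //; split => //; exact: analytic_second_order.
  exists (0%N, f); rewrite leqn0 (count_memPn wL) eqxx; split => //.
  split; first exact: analytic_second_order.
  by move=> z _; rewrite mul1r.
have [ng hng] := choice dec.
pose e w z := (z - w) ^+ ((ng w).1 - count_mem w L)%N * (ng w).2 z *
  (\prod_(y <- L | y != w) (z - y))^-1.
have fe w z : cabs z < 1 -> z \notin L -> f z = \prod_(y <- L) (z - y) * e w z.
  move=> z1 zL; have [cn [_ hf]] := hng w.
  have nz : \prod_(y <- L | y != w) (z - y) != 0.
    move: zL; rewrite -prodB_eq0 (prodB_count_at L w); apply: contraNneq => ->.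
    by rewrite mulr0.
  rewrite hf// /e (prodB_count_at L w) -{1}(subnKC cn) exprD.
  move: (_ ^+ count_mem w L) (_ ^+ (_ - _)) (\prod_(_ <- _ | _) _) nz => a b c nz.
  by field.
exists (fun z => e z z); split => [w w1|z z1].
  have [r r0 hr] := notin_near L w.
  pose r' := Num.min r (1 - cabs w).
  have r'0 : 0 < r' by rewrite lt_min r0 subr_gt0.
  (* A punctured ball about [w] misses the finite list [L], so there the product can be cancelled
     and the two quotients compared. *)
  apply: (@second_order_near _ _ (e w) _ r' r'0) => [h|].
    rewrite lt_min => /andP[hr' h1].
    have [->|h0] := eqVneq h 0; first by rewrite addr0.
    have wh1 : cabs (w + h) < 1 by have := cabsD w h; lra.
    have whL := hr h h0 hr'.
    have nz : \prod_(y <- L) (w + h - y) != 0 by rewrite prodB_eq0.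
    by apply: (mulfI nz); rewrite -!fe.
  have affine y : second_order (fun z => z - y) w.
    by apply: second_orderD; [exact: second_order_id|exact: second_order_cst].
  apply: second_orderM.
    apply: second_orderM; first exact: second_orderX.
    by have [_ [+ _]] := hng w; apply.
  have -> : (fun z => (\prod_(y <- L | y != w) (z - y))^-1) =
      (fun z => \prod_(y <- L | y != w) (- y + 1 * z)^-1).
    apply/funext => z; rewrite -prodfV; apply: eq_bigr => y _.
    by rewrite mul1r addrC.
  apply: second_order_prod => y yw; apply: second_orderV_affine.
  by rewrite mul1r addrC subr_eq0 eq_sym.
have [zL|zL] := boolP (z \in L); last exact: fe.
have [cn [_ hf]] := hng z.
have zc : (0 < count_mem z L)%N by rewrite -has_count has_pred1.
have -> : \prod_(y <- L) (z - y) = 0 by apply/eqP; rewrite prodB_eq0.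
by rewrite hf// subrr expr0n gtn_eqF ?mul0r// (leq_trans zc).
Qed.

(* With [b = rho (z - y) / (rho^2 - y^* z)] the Blaschke factor of the disk of
   radius [rho], [|b|^-2 = 1 + 2 * green_bound rho z y]. *)
Definition green_bound (rho : R) z y : R :=
  (rho ^+ 2 - cabs z ^+ 2) * (rho ^+ 2 - cabs y ^+ 2) / (2 * rho ^+ 2 * cabs (z - y) ^+ 2).

(** After squaring, this is the identity [|rho^2 - conj(y) z|^2 = rho^2 |z - y|^2 + (rho^2 -
    |z|^2)(rho^2 - |y|^2)] together with [1 + u <= exp u]. *)
Lemma blaschke_le (rho : R) z y : 0 < rho -> z != y ->
  cabs ((rho ^+ 2)%:C%C - (y^*)%C * z) / rho
    <= cabs (z - y) * expR (green_bound rho z y).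
Proof.
move=> rho0 zy; have d0 : 0 < cabs (z - y) by rewrite cabs_gt0 subr_eq0.
rewrite ler_pdivrMr// -(@ler_pXn2r _ 2)// ?nnegrE ?cabs_ge0 ?mulr_ge0 ?expR_ge0 ?cabs_ge0
  ?(ltW rho0)//.
have -> : cabs ((rho ^+ 2)%:C%C - (y^*)%C * z) ^+ 2
   = rho ^+ 2 * cabs (z - y) ^+ 2 * (1 + 2 * green_bound rho z y).
  rewrite /green_bound; have d2 : cabs (z - y) != 0 by rewrite gt_eqF.
  have r2 : rho != 0 by rewrite gt_eqF.
  have -> : rho ^+ 2 * cabs (z - y) ^+ 2 * (1 + 2 * ((rho ^+ 2 - cabs z ^+ 2)
    * (rho ^+ 2 - cabs y ^+ 2) / (2 * rho ^+ 2 * cabs (z - y) ^+ 2))) =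
    rho ^+ 2 * cabs (z - y) ^+ 2 + (rho ^+ 2 - cabs z ^+ 2) * (rho ^+ 2 - cabs y ^+ 2).
    by field; rewrite d2 r2.
  rewrite !sqr_cabs; case: (z) (y) => [a b] [c d] /=; ring.
have -> : (cabs (z - y) * expR (green_bound rho z y) * rho) ^+ 2 =
  rho ^+ 2 * cabs (z - y) ^+ 2 * expR (2 * green_bound rho z y).
  by rewrite expRM_natl; ring.
by rewrite ler_wpM2l ?mulr_ge0 ?exprn_ge0 ?cabs_ge0 ?expR_ge1Dx ?(ltW rho0).
Qed.

(** The maximum principle is applied to [|F| exp(- Re G)], where [F] is [f] divided by the Blaschke
    product of [L] for the disk of radius [rho]. Points interior to [X] need no estimate; at the
    others the Green functions bound the inverse Blaschke factors. *)
Lemma jensen_inequality f L X (rho : R) G : analytic_on_disk f -> cabs (f 0) = 1 ->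
  0 < rho -> rho < 1 ->
  (forall w, w \in L -> cabs w < rho) ->
  (forall w, w \in L -> exists2 n, (count_mem w L <= n)%N & vanishes_to f w n) ->
  (forall z, X z -> cabs z <= rho) -> cclosed X -> X 0 ->
  (forall z, X z -> second_order G z) ->
  (forall z, X z -> (exists2 r : R, 0 < r & forall h, cabs h < r -> X (z + h)) \/
     z \notin L /\ (f z != 0 ->
       ln (cabs (f z)) + \sum_(y <- L) green_bound rho z y <= complex.Re (G z))) ->
  \sum_(y <- L) (1 - cabs y / rho) <= complex.Re (G 0).
Proof.
move=> af f01 rho0 rho1 Lrho hL Xrho cX X0 sG bd.
have X1 z : X z -> cabs z < 1 by move=> /Xrho /le_lt_trans; apply.
have [g [sg fg]] := zeros_factor af (fun w wL => lt_trans (Lrho w wL) rho1) hL.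
pose bl y z : R[i] := (rho%:C^-1)%C * ((rho ^+ 2)%:C%C - (y^*)%C * z).
pose F z := g z * \prod_(y <- L) bl y z.
pose Phi z := cabs (F z) * expR (- complex.Re (G z)).
have sF z : X z -> second_order F z.
  move=> Xz; apply: second_orderM; first exact: sg (X1 z Xz).
  apply: second_order_prod => y _; apply: second_orderM; first exact: second_order_cst.
  apply: second_orderD; first exact: second_order_cst.
  under eq_fun do rewrite -mulNr.
  by apply: second_orderM; [exact: second_order_cst|exact: second_order_id].
have cbl y z : cabs (bl y z) = cabs ((rho ^+ 2)%:C%C - (y^*)%C * z) / rho.
  by rewrite /bl cabsM cabsV cabs_real_ge0 ?(ltW rho0)// mulrC.
have : Phi 0 <= 1.
  apply: (@maximum_principle _ X Phi rho) => // [z Xz|z Xz].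
    apply: ccontinuous_atM; first by apply: ccontinuous_at_cabs; exact: sF.
    apply: (@ccontinuous_at_comp (fun t => expR (- t))).
      by move=> t; apply: continuous_comp; [exact: opp_continuous|exact: continuous_expR].
    by apply: ccontinuous_at_Re; exact: sG.
  have [[r r0 hr]|[zL hz]] := bd z Xz.
    right; have [C [r' [r'0 hr']]] := second_order_submean (sF z Xz) (sG z Xz).
    exists C, (Num.min r r'); split; first by rewrite lt_min r0.
    move=> s s0; rewrite lt_min => /andP[sr sr'] h.
    have hs : cabs h = s by rewrite cabs_real_ge0// ltW.
    have ih : cabs ('i%C * h) = s by rewrite cabsM cabsi mul1r.
    split; try (by apply: hr; rewrite ?cabsN ?hs ?ih).
    exact: hr' s s0 sr'.
  (* A zero of [f] outside [L] is a zero of [g], so [Phi] vanishes there and no logarithm is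
     taken. *)
  left; have [fz0|fz0] := eqVneq (f z) 0.
    have gz0 : g z = 0.
      apply/eqP; move/eqP: fz0; rewrite (fg z (X1 z Xz)) mulf_eq0 prodB_eq0.
      by rewrite (negbTE zL).
    by rewrite /Phi /F gz0 mul0r cabs0 mul0r.
  have f0 : 0 < cabs (f z) by rewrite cabs_gt0.
  rewrite /Phi expRN ler_pdivrMr ?expR_gt0// mul1r.
  apply: (@le_trans _ _ (expR (ln (cabs (f z)) + \sum_(y <- L) green_bound rho z y))).
    rewrite expRD lnK// expR_sum (fg z (X1 z Xz)) /F !cabsM !cabs_prod.
    rewrite mulrAC mulrC ler_wpM2r ?cabs_ge0// mulrC -big_split/=.
    rewrite !big_seq; apply: ler_prod => y yL.
    rewrite cabs_ge0 cbl [leRHS]mulrC blaschke_le//.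
    by apply: contraNneq zL => ->.
  by rewrite ler_expR hz.
have F0 : cabs (F 0) = cabs (g 0) * \prod_(y <- L) rho.
  rewrite /F cabsM cabs_prod; congr (_ * _); apply: eq_bigr => y _.
  by rewrite cbl mulr0 subr0 cabs_real_ge0 ?sqr_ge0// expr2 mulfK// gt_eqF.
rewrite /Phi expRN ler_pdivrMr ?expR_gt0// mul1r F0 => hF.
(* Here [1 = |f 0| = |g 0| * prod |y|], and [|y| / rho <= exp(|y| / rho - 1)] for each factor. *)
have : 1 <= expR (complex.Re (G 0) - \sum_(y <- L) (1 - cabs y / rho)).
  rewrite expRD -sumrN expR_sum -{1}f01 (fg 0) ?cabs0// cabsM cabs_prod [leLHS]mulrC.
  apply: (@le_trans _ _ (cabs (g 0) * \prod_(y <- L) (rho * expR (- (1 - cabs y / rho))))).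
    rewrite ler_wpM2l ?cabs_ge0//; apply: ler_prod => y _.
    rewrite cabs_ge0/= sub0r cabsN mulrC -ler_pdivrMr//.
    by rewrite (le_trans _ (expR_ge1Dx _))//; lra.
  rewrite big_split/= mulrA ler_wpM2r//.
  by apply: prodr_ge0 => y _; exact: expR_ge0.
by rewrite -expR0 ler_expR subr_ge0.
Qed.

End Jensen.

(** * Harmonic majorants *)

Section PowersOfTwo.
Context {R : realType}.
Implicit Types x y : R.

Definition pow2 x : R := 2 `^ x.

Lemma pow2D x y : pow2 (x + y) = pow2 x * pow2 y.
Proof. by rewrite /pow2 powRD// pnatr_eq0 implybT. Qed.

Lemma pow2_gt0 x : 0 < pow2 x.
Proof. exact: powR_gt0. Qed.

Lemma pow2_ge0 x : 0 <= pow2 x.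
Proof. exact: powR_ge0. Qed.

Lemma pow2N x : pow2 (- x) = (pow2 x)^-1.
Proof. exact: powRN. Qed.

Lemma pow2B x y : pow2 (x - y) = pow2 x / pow2 y.
Proof. by rewrite pow2D pow2N. Qed.

Lemma pow2M x y : pow2 (x * y) = pow2 x `^ y.
Proof. exact: powRrM. Qed.

Lemma pow2_0 : pow2 0 = 1.
Proof. exact: powRr0. Qed.

Lemma pow2_1 : pow2 1 = 2.
Proof. exact: powRr1. Qed.

Lemma le_pow2 x y : x <= y -> pow2 x <= pow2 y.
Proof. by move=> xy; apply: ler_powR => //; rewrite ler1n. Qed.

Lemma pow2_le1 x : x <= 0 -> pow2 x <= 1.
Proof. by move=> x0; rewrite -pow2_0 le_pow2. Qed.

Lemma pow2_lt1 x : x < 0 -> pow2 x < 1.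
Proof.
by move=> x0; rewrite /pow2 /powR pnatr_eq0/= expR_lt1 nmulr_rlt0// ln_gt0// ltr1n.
Qed.

Lemma lt_pow2 x y : x < y -> pow2 x < pow2 y.
Proof.
by move=> xy; rewrite -(subrK y x) pow2D gtr_pMl ?pow2_gt0// pow2_lt1// subr_lt0.
Qed.

Lemma gt0_powRD (a x y : R) : 0 < a -> a `^ (x + y) = a `^ x * a `^ y.
Proof. by move=> a0; rewrite powRD// lt0r_neq0// implybT. Qed.

Lemma pow2_geometric x n : pow2 (n%:R * x) = pow2 x ^+ n.
Proof. by rewrite mulrC pow2M powR_mulrn// pow2_ge0. Qed.

Lemma pow2_geometric_sum x n : 0 < x ->
  \sum_(i < n) pow2 (- (i%:R * x)) <= (1 - pow2 (- x))^-1.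
Proof.
move=> x0; under eq_bigr do rewrite -mulrN pow2_geometric.
by apply: geometric_sum_le; rewrite ?pow2_ge0// pow2_lt1// oppr_lt0.
Qed.

Lemma powRN_le x y (e : R) : 0 <= e -> 0 < x -> x <= y -> y `^ (- e) <= x `^ (- e).
Proof.
move=> e0 x0 xy; have y0 := lt_le_trans x0 xy.
rewrite !powRN lef_pV2 ?posrE ?powR_gt0//.
by rewrite ge0_ler_powR// nnegrE ltW.
Qed.

Lemma dyadic_scale (d : R) J : pow2 (- J%:R) <= d -> d <= 2 ->
  exists2 i, (i <= J)%N & pow2 (- i%:R) <= d <= 2 * pow2 (- i%:R).
Proof.
elim: J => [|J IH]; first by move=> h1 h2; exists 0%N; rewrite // h1 oppr0 pow2_0 mulr1.
move=> h1 h2; have [dJ|dJ] := leP (pow2 (- J%:R)) d.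
  by have [i iJ hi] := IH dJ h2; exists i => //; exact: leqW.
exists J.+1 => //; rewrite h1/=.
by rewrite -{1}pow2_1 -pow2D -natr1 opprD addrCA subrr addr0 ltW.
Qed.

End PowersOfTwo.

(** * Positive harmonic functions with poles outside the disk *)

Section HarmonicMajorants.
Context {R : realType}.
Implicit Types (z w xi : R[i]) (t e : R).

(** For [|xi| = 1] the pole is at [(1 + t) xi], and the real part is a positive harmonic function on
    the disk when [t >= 0]. For [t = 0] it is half of 1 plus the Poisson kernel at [xi]. *)
Definition pole xi t z : R[i] := (((1 + t)%:C)%C + (- (xi^*)%C) * z)^-1.

Lemma Re_inv z : complex.Re z^-1 = complex.Re z / cabs z ^+ 2.
Proof. by rewrite sqr_cabs; case: z. Qed.

Lemma Re_real_mul (c : R) z : complex.Re ((c%:C)%C * z) = c * complex.Re z.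
Proof. by case: z => a b; rewrite /= mul0r subr0. Qed.

Lemma Re_sum (I : Type) (s : seq I) (F : I -> R[i]) :
  complex.Re (\sum_(i <- s) F i) = \sum_(i <- s) complex.Re (F i).
Proof.
elim/big_rec2: _ => // i x z _ <-.
by case: (F i) z => [a b] [c d].
Qed.

Lemma cabs_1Bconj xi z : cabs xi = 1 -> cabs (1 - (xi^*)%C * z) = cabs (z - xi).
Proof.
move=> xi1; have xi2 := sqr_cabs xi; rewrite xi1 expr1n in xi2.
apply/eqP; rewrite -(@eqrXn2 _ 2)// ?cabs_ge0//; apply/eqP.
rewrite !sqr_cabs; move: xi2; case: (xi) (z) => [a b] [c d] /= h.
transitivity (1 - 2 * (a * c + b * d) + (a ^+ 2 + b ^+ 2) * (c ^+ 2 + d ^+ 2)).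
  by ring.
by rewrite -h mul1r; lra.
Qed.

Lemma Re_pole_den xi t z : cabs xi = 1 ->
  1 + t - cabs z <= complex.Re (((1 + t)%:C)%C + (- (xi^*)%C) * z).
Proof.
move=> xi1; have : complex.Re ((xi^*)%C * z) <= cabs z.
  by rewrite (le_trans (ler_norm _))// (le_trans (Re_le_cabs _))// cabsM cabsC xi1 mul1r.
by case: (xi) (z) => [a b] [c d] /=; lra.
Qed.

Lemma pole_den_neq0 xi t z : cabs xi = 1 -> 0 <= t -> cabs z < 1 ->
  ((1 + t)%:C)%C + (- (xi^*)%C) * z != 0.
Proof.
move=> xi1 t0 z1; have := Re_pole_den t z xi1.
by apply: contraTneq => ->; rewrite /= -ltNge; lra.
Qed.

Lemma second_order_pole xi t z : cabs xi = 1 -> 0 <= t -> cabs z < 1 ->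
  second_order (pole xi t) z.
Proof.
by move=> xi1 t0 z1; apply: second_orderV_affine; exact: pole_den_neq0.
Qed.

Lemma Re_pole_ge0 xi t z : cabs xi = 1 -> 0 <= t -> cabs z < 1 ->
  0 <= complex.Re (pole xi t z).
Proof.
move=> xi1 t0 z1; rewrite /pole Re_inv divr_ge0 ?sqr_ge0//.
by rewrite (le_trans _ (Re_pole_den t z xi1))//; lra.
Qed.

Lemma Re_pole0 xi t : complex.Re (pole xi t 0) = (1 + t)^-1.
Proof.
rewrite /pole mulr0 addr0 Re_inv cabs_real real_normK ?num_real//=.
have [->|t0] := eqVneq (1 + t) 0; first by rewrite mul0r invr0.
by field.
Qed.

Lemma Re_pole_boundary xi z : cabs xi = 1 -> cabs z < 1 ->
  (1 - cabs z) / cabs (z - xi) ^+ 2 <= complex.Re (pole xi 0 z).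
Proof.
move=> xi1 z1; rewrite /pole Re_inv.
have -> : cabs (((1 + 0)%:C)%C + - (xi^*)%C * z) = cabs (z - xi).
  by rewrite addr0 mulNr cabs_1Bconj.
rewrite ler_wpM2r ?invr_ge0 ?sqr_ge0//.
by have := Re_pole_den 0 z xi1; rewrite addr0.
Qed.

(** The denominator has real part at least [t] and modulus at most [3 t]. *)
Lemma Re_pole_scale xi t z : cabs xi = 1 -> cabs z < 1 -> 0 < t ->
  cabs (z - xi) <= 2 * t -> (9 * t)^-1 <= complex.Re (pole xi t z).
Proof.
move=> xi1 z1 t0 hz; rewrite /pole Re_inv.
set v := _ + _; have vt : t <= complex.Re v.
  by have := Re_pole_den t z xi1; rewrite -/v; lra.
have v3 : cabs v <= 3 * t.
  have -> : v = (t%:C)%C + (1 - (xi^*)%C * z).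
    by rewrite /v mulNr [RHS]addrCA addrA -(rmorph1 (real_complex R)) -rmorphD.
  rewrite (le_trans (cabsD _ _))// cabs_real_ge0 ?(ltW t0)// cabs_1Bconj//; lra.
have v0 : 0 < cabs v.
  by rewrite (lt_le_trans t0)// (le_trans vt)// (le_trans (ler_norm _))// Re_le_cabs.
rewrite ler_pdivlMr ?exprn_gt0// (le_trans _ vt)// mulrC ler_pdivrMr ?mulr_gt0//.
have -> : t * (9 * t) = (3 * t) ^+ 2 by ring.
by rewrite lerXn2r ?nnegrE ?cabs_ge0// (le_trans (cabs_ge0 v)).
Qed.

(* A harmonic majorant of [|z - xi|^-e / 9] on [|z - xi| >= 2^-J]: the term of
   index [i] takes care of the annulus [2^-i <= |z - xi| <= 2^(1-i)]. *)
Definition pole_sum xi e J z : R[i] :=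
  \sum_(i < J.+1) ((pow2 (i%:R * (e - 1)))%:C)%C * pole xi (pow2 (- i%:R)) z.

Lemma second_order_pole_sum xi e J z : cabs xi = 1 -> cabs z < 1 ->
  second_order (pole_sum xi e J) z.
Proof.
move=> xi1 z1; apply: second_order_sum => i _.
apply: second_orderM; first exact: second_order_cst.
by apply: second_order_pole; rewrite ?pow2_ge0.
Qed.

Lemma Re_pole_sumE xi e J z : complex.Re (pole_sum xi e J z) =
  \sum_(i < J.+1) pow2 (i%:R * (e - 1)) * complex.Re (pole xi (pow2 (- i%:R)) z).
Proof. by rewrite Re_sum; apply: eq_bigr => i _; rewrite Re_real_mul. Qed.

Lemma Re_pole_sum_ge0 xi e J z : cabs xi = 1 -> cabs z < 1 ->
  0 <= complex.Re (pole_sum xi e J z).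
Proof.
move=> xi1 z1; rewrite Re_pole_sumE sumr_ge0// => i _.
by rewrite mulr_ge0 ?pow2_ge0 ?Re_pole_ge0 ?pow2_ge0.
Qed.

(** All terms are nonnegative, and the one whose annulus contains [z] suffices: it is at least
    [2^(i(e-1)) / (9 * 2^-i) = 2^(i e) / 9]. *)
Lemma Re_pole_sum_ge xi e J z : cabs xi = 1 -> cabs z < 1 -> 0 <= e ->
  pow2 (- J%:R) <= cabs (z - xi) ->
  cabs (z - xi) `^ (- e) <= 9 * complex.Re (pole_sum xi e J z).
Proof.
move=> xi1 z1 e0 hJ.
have d2 : cabs (z - xi) <= 2 by have := cabsD z (- xi); rewrite cabsN; lra.
have [i iJ /andP[di1 di2]] := dyadic_scale hJ d2.
have p0 := pow2_gt0 (- i%:R : R).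
rewrite Re_pole_sumE (bigD1 (Ordinal (iJ : (i < J.+1)%N)))//= mulrDr.
apply: (@le_trans _ _ (9 * (pow2 (i%:R * (e - 1)) * (9 * pow2 (- i%:R))^-1))).
  rewrite (le_trans (powRN_le e0 p0 di1))// -pow2M.
  have -> : pow2 (i%:R * (e - 1)) = pow2 (- i%:R * - e) * pow2 (- i%:R).
    by rewrite -pow2D; congr pow2; ring.
  by rewrite invfM -mulrA le_eqVlt; apply/orP; left; apply/eqP; field; rewrite gt_eqF.
rewrite -[leLHS]addr0 lerD//.
  by rewrite ler_wpM2l// ler_wpM2l ?pow2_ge0// Re_pole_scale.
rewrite mulr_ge0// sumr_ge0// => k _.
by rewrite mulr_ge0 ?pow2_ge0 ?Re_pole_ge0 ?pow2_ge0.
Qed.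

(** Each pole is at most 1 at the origin, and writing [e - 1 = (e - 1 + x) - x] leaves a geometric
    series. For [e = 1 - x] the bound does not depend on [J]. *)
Lemma Re_pole_sum0_le xi e J x : 0 < x ->
  complex.Re (pole_sum xi e J 0) <=
  pow2 (J%:R * Num.max (e - 1 + x) 0) * (1 - pow2 (- x))^-1.
Proof.
move=> x0; rewrite Re_pole_sumE.
apply: le_trans (ler_wpM2l (pow2_ge0 _) (pow2_geometric_sum J.+1 x0)).
rewrite mulr_sumr; apply: ler_sum => i _; rewrite Re_pole0.
apply: (@le_trans _ _ (pow2 (i%:R * (e - 1)))).
  rewrite ler_piMr ?pow2_ge0// invf_le1; first by rewrite lerDl pow2_ge0.
  by rewrite ltr_wpDr// pow2_ge0.
rewrite -pow2D le_pow2// -lerBlDr opprK -mulrDr.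
apply: (@le_trans _ _ (i%:R * Num.max (e - 1 + x) 0)).
  by rewrite ler_wpM2l// le_max lexx.
by rewrite ler_wpM2r ?le_max ?lexx ?orbT// ler_nat -ltnS.
Qed.

(** The two factors are treated differently: the one in [z] is bounded by [2 (1 - |z|) rho^2],
    through [(|z| - rho^2)^2 >= 0], so that [rho^2] cancels. *)
Lemma green_bound_le (rho : R) z w : 0 < rho -> rho <= 1 -> cabs z <= rho ->
  cabs w <= rho ->
  green_bound rho z w <= 2 * ((1 - cabs z) * (1 - cabs w)) / cabs (z - w) ^+ 2.
Proof.
move=> rho0 rho1 zr wr; have z0 := cabs_ge0 z; have w0 := cabs_ge0 w.
have r2 : 0 < rho ^+ 2 by rewrite exprn_gt0.
rewrite /green_bound [(2 * _ * _)^-1]invfM [leLHS]mulrA ler_wpM2r ?invr_ge0 ?sqr_ge0//.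
rewrite ler_pdivrMr ?mulr_gt0//.
have h1 : rho ^+ 2 - cabs z ^+ 2 <= 2 * (1 - cabs z) * rho ^+ 2.
  have : rho ^+ 2 <= 1 by rewrite expr_le1// ltW.
  have := sqr_ge0 (cabs z - rho ^+ 2).
  by move: r2; set s := rho ^+ 2; move: (cabs z) z0 zr => a; nra.
have h2 : rho ^+ 2 - cabs w ^+ 2 <= 2 * (1 - cabs w).
  have : rho ^+ 2 <= 1 by rewrite expr_le1// ltW.
  by have := sqr_ge0 (1 - cabs w); lra.
have h3 : 0 <= rho ^+ 2 - cabs z ^+ 2 by rewrite subr_ge0 lerXn2r ?nnegrE ?(ltW rho0).
have h4 : 0 <= rho ^+ 2 - cabs w ^+ 2 by rewrite subr_ge0 lerXn2r ?nnegrE ?(ltW rho0).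
rewrite (le_trans (ler_pM h3 h4 h1 h2))// le_eqVlt; apply/orP; left; apply/eqP; ring.
Qed.

Lemma green_bound_circle (rho : R) z w : cabs z = rho -> green_bound rho z w = 0.
Proof. by rewrite /green_bound => ->; rewrite subrr !mul0r. Qed.

End HarmonicMajorants.

(** * Zeros at a fixed scale *)

Section ZeroMass.
Context {R : realType}.
Implicit Types (f G : R[i] -> R[i]) (z w xi zeta : R[i]) (L : seq R[i]).
Implicit Types (p q r eps K : R).

(** Multiplicities in [L] are only bounded above by orders of vanishing, so any selection of the
    zeros of [f] qualifies. *)
Definition zero_list f L := forall w, w \in L ->
  exists2 n, (count_mem w L <= n)%N & vanishes_to f w n.

(** Zeros of [f] are excluded because [ln 0] is 0 here instead of minus infinity. *)
Definition growth_bound zeta xi p q r K f := forall z, cabs z < 1 -> f z != 0 ->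
  ln (cabs (f z)) <=
    K / (1 - cabs z) `^ p * (cabs (z - zeta) `^ r / cabs (z - xi) `^ q).

Lemma cabsB_lt2 z xi : cabs xi = 1 -> cabs z < 1 -> cabs (z - xi) < 2.
Proof. by move=> xi1 z1; have := cabsD z (- xi); rewrite cabsN; lra. Qed.

Lemma le_cabsB z xi : cabs xi = 1 -> 1 - cabs z <= cabs (z - xi).
Proof. by move=> <-; rewrite cabsBC cabsB_ge. Qed.

Lemma cabsB_near z h w : `|cabs (z + h - w) - cabs (z - w)| <= cabs h.
Proof.
have := cabsD (z - w) h; have := cabsD (z + h - w) (- h).
rewrite (_ : z - w + h = z + h - w); last by ring.
rewrite (_ : z + h - w - h = z - w); last by ring.
by rewrite cabsN ler_norml => h1 h2; apply/andP; split; lra.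
Qed.

(** The zeros are at least twice as far from the unit circle as the circle of radius [rho], hence
    [|w| / rho - |w| <= 1 - rho <= (1 - |w|) / 2]; this is the factor 2. *)
Lemma zero_mass_le f L (X : set R[i]) (rho : R) G :
  analytic_on_disk f -> cabs (f 0) = 1 -> 0 < rho -> rho < 1 ->
  zero_list f L -> (forall w, w \in L -> 2 * (1 - rho) <= 1 - cabs w) ->
  (forall z, X z -> cabs z <= rho) -> cclosed X -> X 0 ->
  (forall z, X z -> second_order G z) ->
  (forall z, X z -> (exists2 r : R, 0 < r & forall h, cabs h < r -> X (z + h)) \/
     z \notin L /\ (f z != 0 ->
       ln (cabs (f z)) + \sum_(w <- L) green_bound rho z w <= complex.Re (G z))) ->
  \sum_(w <- L) (1 - cabs w) <= 2 * complex.Re (G 0).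
Proof.
move=> af f0 rho0 rho1 fL Lrho Xrho cX X0 sG bd.
have Lrho' w : w \in L -> cabs w < rho by move=> /Lrho; lra.
have := jensen_inequality af f0 rho0 rho1 Lrho' fL Xrho cX X0 sG bd.
move=> /(ler_wpM2l (ler0n R 2)); apply: le_trans.
rewrite mulr_sumr !big_seq; apply: ler_sum => w wL.
have h1 := Lrho w wL; have h2 := cabs_ge0 w.
have : cabs w / rho - cabs w <= 1 - rho.
  rewrite -{2}[cabs w](mulfK (lt0r_neq0 rho0)) -mulrBl.
  rewrite ler_pdivrMr// -{1}[cabs w]mulr1 -mulrBr mulrC ler_wpM2l ?subr_ge0 ?(ltW rho1)//.
  by have := Lrho' w wL; lra.
lra.
Qed.

(** The region is the disk of radius [rho] without the open disk of radius [2^-J] about [xi]. There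
    [|z - xi|^-q] is majorized by a [pole_sum], whose value at 0 yields the power of [2^J], while
    [|z - zeta|^r] is bounded by [2^r]. *)
Lemma zero_mass_away_xi zeta xi p q r eps : cabs zeta = 1 -> cabs xi = 1 ->
  0 <= p -> 0 <= q -> 0 <= r -> 0 < eps ->
  exists2 C : R, 0 < C & forall f K L (k J : nat),
  analytic_on_disk f -> cabs (f 0) = 1 -> 0 < K -> growth_bound zeta xi p q r K f ->
  zero_list f L -> (0 < J)%N ->
  (forall w, w \in L -> pow2 (- k.+1%:R) <= 1 - cabs w /\
     6 * pow2 (- J%:R) <= cabs (w - xi)) ->
  \sum_(w <- L) (1 - cabs w) <=
    C * K * pow2 (k%:R * p) * pow2 (J%:R * pospart (q - 1 + eps)).
Proof.
move=> zeta1 xi1 p0 q0 r0 eps0.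
pose S := (1 - pow2 (- eps))^-1.
have S0 : 0 < S by rewrite invr_gt0 subr_gt0 pow2_lt1// oppr_lt0.
(* [27 = 3 * 9]: the 9 comes from [Re_pole_sum_ge], the 3 from absorbing [T]. The factor [2^(2 p)]
   comes from [1 - |z| >= 2^-(k+2)]. *)
exists (27 * pow2 (2 * p + r) * S); first by rewrite !mulr_gt0// pow2_gt0.
move=> f K L k J af f0 K0 fK fL J0 hL.
pose t : R := pow2 (- k.+2%:R); pose rho := 1 - t; pose d : R := pow2 (- J%:R).
have t0 : 0 < t by exact: pow2_gt0.
have t14 : t <= 4^-1.
  have -> : 4^-1 = pow2 (- 2) :> R by rewrite pow2N /pow2 powR_mulrn// -natrX.
  by rewrite le_pow2// lerN2 ler_nat.
have d0 : 0 < d by exact: pow2_gt0.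
have d12 : d <= 2^-1.
  by rewrite -[2]pow2_1 -pow2N le_pow2// lerN2 ler1n.
have rho0 : 0 < rho by rewrite /rho; lra.
have rho1 : rho < 1 by rewrite /rho; lra.
have t2 : pow2 (- k.+1%:R) = 2 * t.
  by rewrite -{1}pow2_1 -pow2D; congr pow2; rewrite -[k.+2]addn1 natrD; ring.
pose T := \sum_(w <- L) (1 - cabs w).
pose M := 9 * K * pow2 (k%:R * p) * pow2 (2 * p + r).
have M0 : 0 < M by rewrite !mulr_gt0// pow2_gt0.
have T0 : 0 <= T.
  rewrite /T big_seq; apply: sumr_ge0 => w /hL[h _].
  exact: le_trans (pow2_ge0 _) h.
(* The first term majorizes [log |f|]. The second majorizes the Green functions on the arc
   [|z - xi| = d]: zeros are at distance at least [5 d] from it, so they sum to at most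
   [2/25 * T * (1 - |z|) / d^2]. Its value at 0 is [2/25 * T], small enough to be absorbed. *)
pose G z := (M%:C)%C * pole_sum xi q J z + ((2 / 25 * T)%:C)%C * pole xi 0 z.
pose X : set R[i] := [set z | cabs z <= rho /\ d <= cabs (z - xi)].
have G0 : complex.Re (G 0) <= M * (pow2 (J%:R * pospart (q - 1 + eps)) * S) + 2 / 25 * T.
  have -> : complex.Re (G 0) = M * complex.Re (pole_sum xi q J 0)
     + 2 / 25 * T * complex.Re (pole xi 0 0).
    by rewrite -!Re_real_mul /G; case: (_ * _) (_ * _) => [a b] [a' b'].
  rewrite Re_pole0 addr0 invr1 mulr1 lerD2r ler_wpM2l ?(ltW M0)//.
  exact: Re_pole_sum0_le.
suff : T <= 2 * complex.Re (G 0).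
  move=> TG; have : T <= 3 * (M * (pow2 (J%:R * pospart (q - 1 + eps)) * S)).
    have : 0 <= M * (pow2 (J%:R * pospart (q - 1 + eps)) * S).
      by apply: mulr_ge0 (ltW M0) _; apply: mulr_ge0 (pow2_ge0 _) (ltW S0).
    lra.
  move=> h; apply: (le_trans h).
  by rewrite /M le_eqVlt; apply/orP; left; apply/eqP; ring.
have X1 z : X z -> cabs z < 1 by move=> [zr _]; rewrite (le_lt_trans zr).
apply: (zero_mass_le (f := f) (L := L) (X := X) (rho := rho) (G := G)) => //.
- by move=> w /hL[+ _]; rewrite t2 /rho; lra.
- by move=> z [].
- move=> z nX; have [zr|zr] := leP (cabs z) rho; last first.
    exists (cabs z - rho); first by rewrite subr_gt0.
    move=> h hh [zh _]; have := cabsB_ge (z + h) h; rewrite addrK.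
    have := cabsB_ge z (- h); rewrite opprK cabsN; lra.
  have [dz|dz] := leP d (cabs (z - xi)); first by case: nX; split.
  exists (d - cabs (z - xi)); first by rewrite subr_gt0.
  move=> h hh [_ dzh]; have := cabsB_near z h xi; rewrite ler_norml => /andP[]; lra.
- by rewrite /X/= cabs0 sub0r cabsN xi1; split; lra.
- move=> z /X1 z1; apply: second_orderD; apply: second_orderM;
    [exact: second_order_cst|exact: second_order_pole_sum|
     exact: second_order_cst|exact: second_order_pole].
move=> z Xz; have z1 := X1 z Xz; have [zr dz] := Xz.
have lnf : f z != 0 -> ln (cabs (f z)) <= M * complex.Re (pole_sum xi q J z).
  move=> fz; apply: le_trans (fK z z1 fz) _.
  have h1 : ((1 - cabs z) `^ p)^-1 <= pow2 (k%:R * p + 2 * p).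
    have zt : t <= 1 - cabs z by move: zr; rewrite /rho; lra.
    rewrite -powRN (le_trans (powRN_le p0 t0 zt))// /t -pow2M.
    by rewrite le_eqVlt; apply/orP; left; apply/eqP; congr pow2; rewrite -[k.+2]addn2 natrD; ring.
  have h2 : cabs (z - zeta) `^ r <= pow2 r.
    by rewrite /pow2 ge0_ler_powR ?nnegrE ?cabs_ge0// ltW// cabsB_lt2.
  have h3 := Re_pole_sum_ge xi1 z1 q0 dz; rewrite powRN in h3.
  have c0 : 0 <= (cabs (z - xi) `^ q)^-1 by rewrite invr_ge0 powR_ge0.
  have h4 := ler_pM (powR_ge0 _ _) c0 h2 h3.
  have a0 : 0 <= ((1 - cabs z) `^ p)^-1 by rewrite invr_ge0 powR_ge0.
  have h5 := ler_pM a0 (mulr_ge0 (powR_ge0 _ _) c0) h1 h4.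
  rewrite -mulrA; apply: le_trans (ler_wpM2l (ltW K0) h5) _.
  by rewrite /M !pow2D le_eqVlt; apply/orP; left; apply/eqP; ring.
have GE : complex.Re (G z) = M * complex.Re (pole_sum xi q J z)
    + 2 / 25 * T * complex.Re (pole xi 0 z).
  by rewrite -!Re_real_mul /G; case: (_ * _) (_ * _) => [a b] [a' b'].
(* Three kinds of points: the interior, the arc about [xi], and the circle of radius [rho], where
   the Green functions vanish. *)
have [zr'|zr'] := ltP (cabs z) rho; [have [dz'|dz'] := ltP d (cabs (z - xi))|].
- left; exists (Num.min (rho - cabs z) (cabs (z - xi) - d)).
    by rewrite lt_min !subr_gt0 zr'.
  move=> h; rewrite lt_min => /andP[h1 h2]; split.
    by have := cabsD z h; lra.
  by have := cabsB_near z h xi; rewrite ler_norml => /andP[]; lra.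
all: right.
- have zL : z \notin L.
    apply/negP => /hL[_]; rewrite -/d; lra.
  split => // fz; rewrite GE lerD ?lnf//.
  rewrite /T mulr_sumr mulr_suml !big_seq; apply: ler_sum => w wL.
  have [hw1 hw2] := hL w wL; rewrite -/d in hw2.
  have w1 : 0 <= 1 - cabs w by rewrite (le_trans _ hw1)// pow2_ge0.
  have wr : cabs w <= rho by move: hw1; rewrite t2 /rho; lra.
  have d5 : 5 * d <= cabs (z - w).
    have := cabsD (w - z) (z - xi); rewrite [cabs (w - z)]cabsBC addrA subrK; lra.
  rewrite (le_trans (green_bound_le rho0 (ltW rho1) zr wr))//.
  have := Re_pole_boundary xi1 z1; have -> : cabs (z - xi) = d by apply/eqP; rewrite eq_le dz dz'.
  move=> /(ler_wpM2l w1) h.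
  apply: (@le_trans _ _ (2 / 25 * ((1 - cabs w) * ((1 - cabs z) / d ^+ 2)))).
    rewrite ler_pdivrMr ?exprn_gt0 ?(lt_le_trans _ d5) ?mulr_gt0//.
    have : (5 * d) ^+ 2 <= cabs (z - w) ^+ 2.
      by rewrite lerXn2r ?nnegrE ?cabs_ge0 ?mulr_ge0 ?(ltW d0).
    rewrite exprMn => h25.
    have u0 : 0 <= 2 / 25 * ((1 - cabs w) * ((1 - cabs z) / d ^+ 2)).
      by rewrite !mulr_ge0 ?invr_ge0 ?exprn_ge0 ?(ltW d0) ?subr_ge0 ?(ltW z1)// -subr_ge0.
    apply: le_trans (ler_wpM2l u0 h25); rewrite le_eqVlt; apply/orP; left; apply/eqP.
    by field; rewrite gt_eqF.
  by rewrite -[leRHS]mulrA ler_wpM2l.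
- have ze : cabs z = rho by apply/eqP; rewrite eq_le zr zr'.
  have zL : z \notin L.
    by apply/negP => /hL[]; rewrite t2 ze /rho; lra.
  split => // fz; rewrite GE big1; last by move=> w _; exact: green_bound_circle.
  rewrite addr0 (le_trans (lnf fz))// lerDl !mulr_ge0// Re_pole_ge0//.
Qed.

(** To be read with [a = 1 - |z|], [D = |z - zeta|], [b = |z - xi|] and [s = min(p, r)]. Near
    [zeta], [a >= t] and [D <= 2 d] suffice. Farther away, [a >= eta D] turns [a^-p D^s] into
    [D^(s-p)], which decreases in [D] because [s <= p], so [D] may be replaced by [d]. *)
Lemma growth_near_zeta (p q r s a b c d D t eta : R) :
  0 <= p -> 0 <= q -> s <= p -> s <= r -> 0 <= s ->
  0 < t -> t <= d -> t <= a -> 0 < D -> D <= 2 -> 0 < c -> 0 < eta -> eta <= 1 ->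
  (D <= 2 * d /\ c <= b) \/ (d <= D /\ eta * D <= a /\ eta * c <= b) ->
  (a `^ p)^-1 * (D `^ r / b `^ q) <=
  (eta `^ (- p) * t `^ (- p)) * (pow2 r * d `^ s) * (eta `^ (- q) * c `^ (- q)).
Proof.
move=> p0 q0 sp sr s0 t0 td ta D0 D2 c0 e0 e1 H.
have d0 : 0 < d by rewrite (lt_le_trans t0).
have a0 : 0 < a by rewrite (lt_le_trans t0).
have eta_ge1 x : 0 <= x -> 1 <= eta `^ (- x).
  by move=> x0; have := powRN_le x0 e0 e1; rewrite powR1.
have Dr : D `^ r <= pow2 (r - s) * D `^ s.
  rewrite -{1}(subrK s r) gt0_powRD//.
  rewrite ler_wpM2r ?powR_ge0//.
  by apply: ge0_ler_powR; rewrite ?subr_ge0 ?nnegrE ?(ltW D0).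
have bq : b `^ (- q) <= eta `^ (- q) * c `^ (- q).
  case: H => [[_ cb]|[_ [_ cb]]]; last first.
    by rewrite -powRM ?(ltW e0) ?(ltW c0)// powRN_le// mulr_gt0.
  by rewrite (le_trans (powRN_le q0 c0 cb))// ler_peMl ?powR_ge0// eta_ge1.
rewrite -(powRN a p) -(powRN b q) [leLHS]mulrA.
apply: (ler_pM _ (powR_ge0 _ _) _ bq); first exact: mulr_ge0 (powR_ge0 _ _) (powR_ge0 _ _).
case: H => [[Dd _]|[dD [Da _]]].
  apply: (ler_pM (powR_ge0 _ _) (powR_ge0 _ _)).
    by rewrite (le_trans (powRN_le p0 t0 ta))// ler_peMl ?powR_ge0// eta_ge1.
  rewrite (le_trans Dr)// (_ : pow2 r = pow2 (r - s) * 2 `^ s); last first.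
    by rewrite -pow2D subrK.
  rewrite -mulrA -powRM ?(ltW d0)// ler_wpM2l ?pow2_ge0//.
  by apply: ge0_ler_powR; rewrite // nnegrE ?mulr_ge0// ltW.
have h1 : a `^ (- p) <= eta `^ (- p) * D `^ (- p).
  by rewrite -powRM ?(ltW e0) ?(ltW D0)// powRN_le// mulr_gt0.
apply: le_trans (ler_pM (powR_ge0 _ _) (powR_ge0 _ _) h1 Dr) _.
have h2 : D `^ (- p) * D `^ s <= t `^ (- p) * d `^ s.
  rewrite -gt0_powRD//.
  apply: (@le_trans _ _ (d `^ (- p) * d `^ s)).
    rewrite -gt0_powRD//.
    by rewrite (_ : - p + s = - (p - s)) ?powRN_le ?subr_ge0//; ring.
  by rewrite ler_wpM2r ?powR_ge0// powRN_le.
have h3 : pow2 (r - s) <= pow2 r by rewrite le_pow2// gerBl.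
have h4 := ler_pM (pow2_ge0 _) (mulr_ge0 (powR_ge0 _ _) (powR_ge0 _ _)) h3 h2.
have h5 := ler_wpM2l (powR_ge0 eta (- p)) h4.
move: h5; congr (_ <= _); ring.
Qed.

(** The gain [2^(- j min(p, r))] comes from the smallness of the growth bound near [zeta]. The
    region must leave the disk about [zeta] at height [eta |z - zeta|] above the circle, and the
    Green functions on that slanted boundary cost the factor [2^(j kap (p + q))]. *)
Lemma zero_mass_near_zeta zeta xi p q r kap : cabs zeta = 1 -> cabs xi = 1 ->
  zeta != xi -> 0 <= p -> 0 <= q -> 0 <= r -> 0 < kap -> kap <= 1 ->
  exists2 C : R, 0 < C & forall f K L (k j : nat),
  analytic_on_disk f -> cabs (f 0) = 1 -> 0 < K -> growth_bound zeta xi p q r K f ->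
  zero_list f L -> 4 * pow2 (- j%:R) <= cabs (zeta - xi) -> (j <= k.+2)%N ->
  (forall w, w \in L -> pow2 (- k.+1%:R) <= 1 - cabs w /\
     cabs (w - zeta) <= pow2 (- j%:R)) ->
  \sum_(w <- L) (1 - cabs w) <=
    C * K * pow2 (k%:R * p) * pow2 (- (j%:R * Num.min p r)) * pow2 (j%:R * kap * (p + q)).
Proof.
move=> zeta1 xi1 zx p0 q0 r0 kap0 kap1.
(* [288 = 4 * 72] makes the value at 0 of the Green majorant at most [T / 4], so [T <= 2 M + T / 2]
   and hence [T <= 4 M]. *)
pose S := (1 - pow2 (- kap))^-1; pose N := 288 * S; pose s := Num.min p r.
have S1 : 1 <= S.
  by rewrite invf_ge1 ?subr_gt0 ?pow2_lt1 ?oppr_lt0// gerBl pow2_ge0.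
have S0 : 0 < S by rewrite (lt_le_trans _ S1).
have N1 : 1 <= N by rewrite /N; lra.
have N0 : 0 < N by rewrite (lt_le_trans _ N1).
pose c := cabs (zeta - xi) / 2.
have c0 : 0 < c by rewrite divr_gt0// cabs_gt0 subr_eq0.
have s0 : 0 <= s by rewrite le_min p0 r0.
have sp : s <= p by rewrite ge_min lexx.
have sr : s <= r by rewrite ge_min lexx orbT.
exists (4 * pow2 (r + 2 * p) * c `^ (- q) * N `^ (p + q)).
  by rewrite !mulr_gt0 ?pow2_gt0 ?powR_gt0.
move=> f K L k j af f0 K0 fK fL j4 jk hL.
pose t : R := pow2 (- k.+2%:R); pose rho := 1 - t; pose d : R := pow2 (- j%:R).
have t0 : 0 < t by exact: pow2_gt0.
have t14 : t <= 4^-1.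
  have -> : 4^-1 = pow2 (- 2) :> R by rewrite pow2N /pow2 powR_mulrn// -natrX.
  by rewrite le_pow2// lerN2 ler_nat.
have d0 : 0 < d by exact: pow2_gt0.
have td : t <= d by rewrite le_pow2// lerN2 ler_nat.
have c1 : c <= 1.
  have := cabsD zeta (- xi); rewrite cabsN zeta1 xi1 /c; lra.
have dc : 2 * d <= c by rewrite /c; move: j4; rewrite -/d; lra.
have rho0 : 0 < rho by rewrite /rho; lra.
have rho1 : rho < 1 by rewrite /rho; lra.
have t2 : pow2 (- k.+1%:R) = 2 * t.
  by rewrite -{1}pow2_1 -pow2D; congr pow2; rewrite -[k.+2]addn1 natrD; ring.
pose T := \sum_(w <- L) (1 - cabs w).
have T0 : 0 <= T.
  rewrite /T big_seq; apply: sumr_ge0 => w /hL[h _].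
  exact: le_trans (pow2_ge0 _) h.
pose eta := pow2 (- (j%:R * kap)) / N.
have e0 : 0 < eta by rewrite divr_gt0// pow2_gt0.
have e1 : eta <= 1.
  rewrite ler_pdivrMr// mul1r (le_trans _ N1)// pow2_le1// oppr_le0.
  by rewrite mulr_ge0// ltW.
pose M := K * ((eta `^ (- p) * t `^ (- p)) * (pow2 r * d `^ s) * (eta `^ (- q) * c `^ (- q))).
have M0 : 0 < M by rewrite !mulr_gt0 ?pow2_gt0 ?powR_gt0.
have ME : 4 * M = 4 * pow2 (r + 2 * p) * c `^ (- q) * N `^ (p + q) * K * pow2 (k%:R * p)
   * pow2 (- (j%:R * s)) * pow2 (j%:R * kap * (p + q)).
  have -> : M = K * ((eta `^ (- (p + q)) * t `^ (- p)) * (pow2 r * d `^ s) * c `^ (- q)).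
    rewrite opprD gt0_powRD// /M; move: (eta `^ _) (eta `^ _) (t `^ _) (pow2 r) => x1 x2 x3 x4.
    by move: (d `^ s) (c `^ _) => x5 x6; ring.
  have -> : eta `^ (- (p + q)) = N `^ (p + q) * pow2 (j%:R * kap * (p + q)).
    rewrite powRN /eta powRM ?pow2_ge0 ?invr_ge0 ?(ltW N0)// -pow2M.
    rewrite -(powR_inv1 (ltW N0)) -powRrM mulN1r powRN mulNr pow2N.
    by rewrite invfM !invrK mulrC.
  have -> : t `^ (- p) = pow2 (k%:R * p) * pow2 (2 * p).
    by rewrite /t -pow2M -pow2D; congr pow2; rewrite -[k.+2]addn2 natrD; ring.
  have -> : d `^ s = pow2 (- (j%:R * s)) by rewrite /d -pow2M mulNr.
  rewrite [pow2 (r + _)]pow2D; ring.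
pose A := 72 * eta * T * pow2 (j%:R * kap).
have eT0 : 0 <= 8 * eta * T by apply: mulr_ge0 T0; apply: mulr_ge0 (ltW e0).
have A0 : 0 <= A.
  by apply: mulr_ge0 (pow2_ge0 _); apply: mulr_ge0 T0; apply: mulr_ge0 (ltW e0).
have AS : A * S = T / 4.
  rewrite /A /eta /N pow2N; field.
  by rewrite !gt_eqF ?pow2_gt0.
(* The exponent is [1 - kap] because exponent 1 would give a bound at 0 growing with [j]; the
   missing [|z - zeta|^-kap] is at most [2^(j kap)], which [eta] compensates. *)
pose U := pole_sum zeta (1 - kap) j.
pose G z := (M%:C)%C + (A%:C)%C * U z.
have GE z : complex.Re (G z) = M + A * complex.Re (U z).
  by rewrite -Re_real_mul /G; case: (_ * _) => [a b].
(* The disk of radius [2 d] leaves room around the zeros, which are within [d] of [zeta]; the second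
   alternative contains the origin since [eta <= 1]. *)
pose X : set R[i] := [set z | cabs z <= rho /\
  (cabs (z - zeta) <= 2 * d \/ eta * cabs (z - zeta) <= 1 - cabs z)].
have G0 : complex.Re (G 0) <= M + T / 4.
  rewrite GE lerD2l -AS ler_wpM2l//.
  have := Re_pole_sum0_le zeta (1 - kap) j kap0.
  rewrite (_ : 1 - kap - 1 + kap = 0); last by ring.
  by rewrite maxxx mulr0 pow2_0 mul1r.
suff : T <= 2 * complex.Re (G 0) by rewrite -/s -ME -/T; clear -G0; lra.
clear ME AS G0 j4 N1 N0 S1 S0.
have X1 z : X z -> cabs z < 1 by move=> [zr _]; rewrite (le_lt_trans zr).
apply: (zero_mass_le (f := f) (L := L) (X := X) (rho := rho) (G := G)) => //.
- by move=> w /hL[+ _]; rewrite t2 /rho; clear; lra.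
- by move=> z [].
- move=> z nX; have [zr|zr] := leP (cabs z) rho; last first.
    exists (cabs z - rho); first by rewrite subr_gt0.
    move=> h hh [zh _]; have := cabsB_ge z (- h); rewrite opprK cabsN; clear -hh zh; lra.
  have [dz|dz] := leP (cabs (z - zeta)) (2 * d); first by case: nX; split => //; left.
  have [ez|ez] := leP (eta * cabs (z - zeta)) (1 - cabs z).
    by case: nX; split => //; right.
  exists (Num.min (cabs (z - zeta) - 2 * d) ((eta * cabs (z - zeta) - (1 - cabs z)) / 2)).
    by rewrite lt_min subr_gt0 dz divr_gt0// subr_gt0.
  move=> h; rewrite lt_min => /andP[h1 h2] [_].
  have := cabsB_near z h zeta; rewrite ler_norml => /andP[h3 h4].
  have h5 := cabsD (z + h) (- h); rewrite addrK cabsN in h5.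
  move=> [|]; first by clear -h1 h3; lra.
  have : eta * (cabs (z - zeta) - cabs h) <= eta * cabs (z + h - zeta).
    by rewrite ler_wpM2l ?(ltW e0)//; clear -h3; lra.
  have : eta * cabs h <= cabs h by rewrite ler_piMl// cabs_ge0.
  rewrite mulrBr; clear -h2 h5; lra.
- rewrite /X/= cabs0 sub0r cabsN zeta1; split; first exact: ltW.
  by right; rewrite mulr1 subr0.
- move=> z /X1 z1; apply: second_orderD; first exact: second_order_cst.
  by apply: second_orderM; [exact: second_order_cst|exact: second_order_pole_sum].
move=> z Xz; have z1 := X1 z Xz; have [zr dz] := Xz.
have U0 : 0 <= complex.Re (U z) by apply: Re_pole_sum_ge0.
have D2 : cabs (z - zeta) <= 2 by rewrite ltW// cabsB_lt2.
have zD : 1 - cabs z <= cabs (z - zeta) by exact: le_cabsB.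
have D0 : 0 < cabs (z - zeta) by rewrite (lt_le_trans _ zD)// subr_gt0.
have zt : t <= 1 - cabs z by move: zr; rewrite /rho; clear; lra.
have zxi : 1 - cabs z <= cabs (z - xi) by exact: le_cabsB.
have tri : 2 * c <= cabs (z - zeta) + cabs (z - xi).
  rewrite /c mulrC divfK// [cabs (z - zeta)]cabsBC.
  by have := cabsD (zeta - z) (z - xi); rewrite addrA subrK.
have lnf : f z != 0 -> ln (cabs (f z)) <= M.
  move=> fz; apply: le_trans (fK z z1 fz) _.
  rewrite -mulrA /M ler_wpM2l ?(ltW K0)//.
  apply: growth_near_zeta => //.
  have [Dd|Dd] := leP (cabs (z - zeta)) (2 * d); [left|right].
    by split => //; clear -tri dc Dd; lra.
  have ez : eta * cabs (z - zeta) <= 1 - cabs z by case: dz => //; rewrite leNgt Dd.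
  split; [by clear -d0 Dd; lra|split => //].
  (* Within [c] of [zeta] the point is at least [c] from [xi]; otherwise
     [|z - xi| >= 1 - |z| >= eta |z - zeta|]. *)
  have [Dc|Dc] := leP (cabs (z - zeta)) c.
    have ec : eta * c <= c by rewrite ler_piMl// ltW.
    by clear -ec tri Dc; lra.
  by rewrite (le_trans _ zxi)// (le_trans _ ez)// ler_wpM2l// ltW.
have [ze|zr'] := eqVneq (cabs z) rho.
  right; have zL : z \notin L.
    by apply/negP => /hL[]; rewrite t2 ze /rho; clear -t0; lra.
  split => // fz; rewrite big1; last by move=> w _; exact: green_bound_circle.
  by rewrite addr0 GE (le_trans (lnf fz))// lerDl mulr_ge0.
have zlt : cabs z < rho by rewrite lt_neqAle zr' zr.
have [Dd|Dd] := ltP (cabs (z - zeta)) (2 * d).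
  left; exists (Num.min (rho - cabs z) (2 * d - cabs (z - zeta))).
    by rewrite lt_min !subr_gt0 zlt.
  move=> h; rewrite lt_min => /andP[h1 h2]; split; first by have := cabsD z h; clear -h1; lra.
  by left; have := cabsB_near z h zeta; rewrite ler_norml => /andP[]; clear -h2; lra.
have [De|De] := ltP (eta * cabs (z - zeta)) (1 - cabs z).
  left; exists (Num.min (rho - cabs z) ((1 - cabs z - eta * cabs (z - zeta)) / 2)).
    by rewrite lt_min subr_gt0 zlt divr_gt0// subr_gt0.
  move=> h; rewrite lt_min => /andP[h1 h2].
  have zh := cabsD z h.
  split; first by clear -zh h1; lra.
  right; have := cabsB_near z h zeta; rewrite ler_norml => /andP[h3 h4].
  have : eta * cabs (z + h - zeta) <= eta * (cabs (z - zeta) + cabs h).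
    by rewrite ler_wpM2l ?(ltW e0)//; clear -h4; lra.
  have : eta * cabs h <= cabs h by rewrite ler_piMl// cabs_ge0.
  rewrite mulrDr; clear -h2 zh; lra.
(* On the slanted boundary [1 - |z| <= eta |z - zeta|], and every zero is at distance at least
   [|z - zeta| / 2], so each Green function is at most [8 eta (1 - |w|) / |z - zeta|]. *)
right; have zL : z \notin L.
  by apply/negP => /hL[_]; rewrite -/d; clear -d0 Dd; lra.
split => // fz; rewrite GE lerD ?lnf//.
have DU : (cabs (z - zeta))^-1 <= pow2 (j%:R * kap) * (9 * complex.Re (U z)).
  have dD : d <= cabs (z - zeta) by clear -d0 Dd; lra.
  have := Re_pole_sum_ge zeta1 z1 (_ : 0 <= 1 - kap) dD; rewrite subr_ge0 => /(_ kap1) h.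
  have := powRN_le (ltW kap0) d0 dD; rewrite /d -pow2M mulrNN => h'.
  have := ler_pM (powR_ge0 _ _) (powR_ge0 _ _) h' h.
  rewrite -gt0_powRD//.
  by rewrite (_ : - kap + - (1 - kap) = - 1) ?powR_inv1 ?cabs_ge0//; ring.
apply: (@le_trans _ _ (8 * eta * T * (cabs (z - zeta))^-1)); last first.
  apply: le_trans (ler_wpM2l eT0 DU) _.
  rewrite le_eqVlt; apply/orP; left; apply/eqP; rewrite /A; ring.
rewrite /T mulr_sumr mulr_suml !big_seq; apply: ler_sum => w wL.
have [hw1 hw2] := hL w wL; rewrite -/d in hw2.
have w1 : 0 <= 1 - cabs w by rewrite (le_trans _ hw1)// pow2_ge0.
have wr : cabs w <= rho by move: hw1; rewrite t2 /rho; clear -t0; lra.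
have dw : cabs (z - zeta) / 2 <= cabs (z - w).
  have := cabsD (z - w) (w - zeta); rewrite addrA subrK; clear -hw2 Dd; lra.
rewrite (le_trans (green_bound_le rho0 (ltW rho1) zr wr))//.
rewrite ler_pdivrMr ?exprn_gt0 ?(lt_le_trans _ dw) ?divr_gt0//.
have h2 : (cabs (z - zeta) / 2) ^+ 2 <= cabs (z - w) ^+ 2.
  by rewrite lerXn2r ?nnegrE ?cabs_ge0 ?divr_ge0 ?(ltW D0).
have u0 : 0 <= 8 * eta * (1 - cabs w) * (cabs (z - zeta))^-1.
  apply: mulr_ge0; last by rewrite invr_ge0 ltW.
  by apply: mulr_ge0 w1; apply: mulr_ge0 (ltW e0).
apply: le_trans (ler_wpM2l u0 h2).
have -> : 8 * eta * (1 - cabs w) * (cabs (z - zeta))^-1 * (cabs (z - zeta) / 2) ^+ 2 =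
  2 * ((eta * cabs (z - zeta)) * (1 - cabs w)) by field; rewrite gt_eqF.
by rewrite ler_wpM2l// ler_wpM2r.
Qed.

End ZeroMass.

(** * Summation over the scales *)

Section DyadicSummation.
Context {R : realType}.
Implicit Types (f : R[i] -> R[i]) (w xi zeta : R[i]) (p q r eps K : R).

Lemma pow2_small (x : R) : 0 < x -> exists n : nat, pow2 (- n%:R) <= x.
Proof.
move=> x0; exists (Num.truncn x^-1).+1.
rewrite pow2N -[x in leRHS]invrK lef_pV2 ?posrE ?pow2_gt0 ?invr_gt0//.
apply: ltW; apply: lt_le_trans (truncnS_gt _) _.
rewrite /pow2 powR_mulrn// -natrX ler_nat ltnW// ltn_expl//.
Qed.

Lemma dyadic_index (x : R) : 0 < x -> x <= 1 ->
  exists k : nat, pow2 (- k.+1%:R) < x /\ x <= pow2 (- k%:R).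
Proof.
move=> x0 x1; have [n nx] := pow2_small x0.
have {nx} : pow2 (- n.+1%:R) < x.
  by apply: lt_le_trans nx; rewrite lt_pow2// ltrN2 ltr_nat.
elim: n => [|n IH] hn; first by exists 0%N; rewrite oppr0 pow2_0.
have [hx|hx] := ltP (pow2 (- n.+1%:R)) x; first exact: IH.
by exists n.+1.
Qed.

(** The pairs over a fixed [w] carry distinct positive orders, so by counting one of these orders is
    at least their number. *)
Lemma zero_list_map f (s : seq (R[i] * nat)) : uniq s ->
  (forall x, x \in s -> zeros_mult f x) -> zero_list f (map fst s).
Proof.
move=> us sf w /mapP[x0 x0s w0].
pose t := [seq x <- s | x.1 == w]; pose ns := map snd t.
have st : size ns = count_mem w (map fst s).
  by rewrite size_map size_filter count_map.
have uns : uniq ns.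
  rewrite map_inj_in_uniq ?filter_uniq// => x y.
  rewrite !mem_filter => /andP[/eqP x1 _] /andP[/eqP y1 _] xy.
  by rewrite [x]surjective_pairing [y]surjective_pairing x1 y1 xy.
have sz : (0 < size ns)%N.
  by rewrite st -has_count has_pred1; apply/mapP; exists x0.
have [n nns hn] : exists2 n, n \in ns & (size ns <= n)%N.
  apply: contrapT => H.
  have : (size ns <= size (iota 1 (size ns).-1))%N.
    apply: uniq_leq_size => // n nns; rewrite mem_iota add1n prednK//.
    have -> : (0 < n)%N.
      move: nns => /mapP[x]; rewrite mem_filter => /andP[_ /sf[_ [x2 _]] ->].
      exact: x2.
    by rewrite /= ltnNge; apply/negP => hn; apply: H; exists n.
  by rewrite size_iota leqNgt prednK// leqnn.
exists n; first by rewrite -st.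
move: nns => /mapP[x]; rewrite mem_filter => /andP[/eqP <- /sf[_ [_ hx]] ->].
exact: hx.
Qed.

Lemma sum_by_level (T : Type) (A : seq T) (P : pred T) (wt : T -> R) (k : T -> nat) N :
  all (fun x => (k x < N)%N) A ->
  \sum_(x <- A | P x) wt x = \sum_(i < N) \sum_(x <- A | P x && (k x == i)) wt x.
Proof.
elim: A => [_|x A IH /= /andP[kN /IH {}IH]].
  by rewrite big_nil big1// => i _; rewrite big_nil.
under [RHS]eq_bigr do rewrite big_cons.
rewrite big_cons; have [Px|_]/= := boolP (P x); last exact: IH.
rewrite IH (bigD1 (Ordinal kN))//= [RHS](bigD1 (Ordinal kN))//= eqxx addrA.
congr (_ + _); apply: eq_bigr => i iN; rewrite ifN// eq_sym.
by apply: contra iN => /eqP e; apply/eqP/val_inj.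
Qed.

Lemma dyadic_double_sum (T : Type) (A : seq T) (wt : T -> R) (k J : T -> nat)
    (B e : R) : 0 < e -> 0 <= B ->
  (forall k' J' : nat, \sum_(x <- A | (k x == k') && (J x == J')) wt x
     <= B * (pow2 (- (k'%:R * e)) * pow2 (- (J'%:R * e)))) ->
  \sum_(x <- A) wt x <= B * ((1 - pow2 (- e))^-1 * (1 - pow2 (- e))^-1).
Proof.
move=> e0 B0 H.
have [N] : exists N, all (fun x => (k x < N)%N && (J x < N)%N) A.
  (* The sum of all indices is a crude common bound for them. *)
  exists (\sum_(x <- A) (k x + J x)).+1; elim: A {H} => //= x A IH.
  rewrite big_cons !ltnS -addnA leq_addr addnCA leq_addr/=.
  apply: sub_all IH => y /andP[h1 h2].
  by rewrite (leq_trans h1) ?(leq_trans h2)// ltnS !addnA leq_addl.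
rewrite all_predI => /andP[kN JN].
rewrite (sum_by_level predT wt kN)/=.
under eq_bigr do rewrite (sum_by_level _ wt JN).
apply: (@le_trans _ _ (\sum_(i < N) \sum_(l < N)
    B * (pow2 (- (i%:R * e)) * pow2 (- (l%:R * e))))).
  by apply: ler_sum => i _; apply: ler_sum => l _; exact: H.
under eq_bigr do rewrite -mulr_sumr -mulr_sumr.
rewrite -mulr_sumr -mulr_suml ler_wpM2l// ler_pM ?pow2_geometric_sum//.
- by apply: sumr_ge0 => i _; exact: pow2_ge0.
- by apply: sumr_ge0 => i _; exact: pow2_ge0.
Qed.

End DyadicSummation.

(** * Weighted sums far from and near [zeta] *)

Section WeightedSums.
Context {R : realType}.
Implicit Types (f : R[i] -> R[i]) (w xi zeta : R[i]) (p q r eps K : R).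

Definition zero_weight zeta xi p q r eps (w : R[i]) : R :=
  (1 - cabs w) `^ (p + 1 + eps) * cabs (w - xi) `^ (pospart (q - 1 + eps))
  / cabs (w - zeta) `^ (Num.min p r).

(** One factor [1 - |w|] is kept aside for the zero mass estimates; the others are frozen at the
    dyadic scale. *)
Lemma zero_weight_le zeta xi p q r eps w (k : nat) (a b : R) :
  0 <= p -> 0 <= r -> 0 < eps -> cabs w < 1 -> 1 - cabs w <= pow2 (- k%:R) ->
  cabs (w - xi) <= a -> 0 < b -> b <= cabs (w - zeta) ->
  zero_weight zeta xi p q r eps w <=
  pow2 (- (k%:R * (p + eps))) * a `^ (pospart (q - 1 + eps)) * b `^ (- Num.min p r)
  * (1 - cabs w).
Proof.
move=> p0 r0 eps0 w1 wk wa b0 wb.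
have u0 : 0 < 1 - cabs w by rewrite subr_gt0.
have b1 : 0 <= pospart (q - 1 + eps) by rewrite le_max lexx orbT.
have h1 : (1 - cabs w) `^ (p + eps) <= pow2 (- (k%:R * (p + eps))).
  rewrite -mulNr pow2M; apply: ge0_ler_powR; rewrite ?nnegrE ?pow2_ge0 ?(ltW u0)//.
  by rewrite addr_ge0// ltW.
have h2 : cabs (w - xi) `^ pospart (q - 1 + eps) <= a `^ pospart (q - 1 + eps).
  by apply: ge0_ler_powR; rewrite ?nnegrE ?cabs_ge0 ?(le_trans (cabs_ge0 _) wa).
have h3 : cabs (w - zeta) `^ (- Num.min p r) <= b `^ (- Num.min p r).
  by apply: powRN_le => //; rewrite le_min p0.
have h4 := ler_pM (powR_ge0 _ _) (powR_ge0 _ _) h1 h2.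
have h5 := ler_pM (mulr_ge0 (powR_ge0 _ _) (powR_ge0 _ _)) (powR_ge0 _ _) h4 h3.
apply: le_trans (ler_wpM2r (ltW u0) h5).
rewrite /zero_weight -powRN (addrAC p) (gt0_powRD (p + eps) 1 u0) (powRr1 (ltW u0)).
by rewrite le_eqVlt; apply/orP; left; apply/eqP; ring.
Qed.

Lemma exists_dyadic_index : exists idx : R -> nat, forall x : R, 0 < x -> x <= 1 ->
  pow2 (- (idx x).+1%:R) < x /\ x <= pow2 (- (idx x)%:R).
Proof.
have H (x : R) : exists k : nat, 0 < x -> x <= 1 ->
    pow2 (- k.+1%:R) < x /\ x <= pow2 (- k%:R).
  have [x0|x0] := ltP 0 x; last by exists 0%N.
  have [x1|x1] := leP x 1; last by exists 0%N.
  by have [k hk] := dyadic_index x0 x1; exists k.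
by have [idx hidx] := choice H; exists idx.
Qed.

Lemma lt_pow2_nat (m n : nat) : pow2 (- m%:R : R) < pow2 (- n%:R) -> (n < m)%N.
Proof. by rewrite ltnNge; apply: contraTN => mn; rewrite -leNgt le_pow2// lerN2 ler_nat. Qed.

Lemma pow2_succ n : pow2 (- n.+1%:R) = pow2 (- n%:R) / 2 :> R.
Proof.
rewrite (_ : - n.+1%:R = - n%:R - 1) ?pow2B ?pow2_1//.
by rewrite -[n.+1]addn1 natrD opprD.
Qed.

(** The mass bound is required only for a nonempty class, because the relations between its indices
    are read off a member [x0]. *)
Lemma class_sum_le (A : seq (R[i] * nat)) (P : pred (R[i] * nat))
    (wt : R[i] -> R) (c B D : R) :
  0 <= c -> 0 <= D ->
  (forall x, x \in A -> P x -> wt x.1 <= c * (1 - cabs x.1)) ->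
  (forall x0, x0 \in A -> P x0 ->
     \sum_(w <- map fst [seq x <- A | P x]) (1 - cabs w) <= B /\ c * B <= D) ->
  \sum_(x <- A | P x) wt x.1 <= D.
Proof.
move=> c0 D0 hwt hB; have [/hasP[x0 x0A Px0]|] := boolP (has P A); last first.
  move=> /hasPn nP; rewrite big_seq_cond big1// => x /andP[xA Px].
  by have := nP x xA; rewrite Px.
have [h1 h2] := hB x0 x0A Px0; apply: le_trans h2.
apply: le_trans (ler_wpM2l c0 h1).
rewrite big_map big_filter mulr_sumr [leLHS]big_seq_cond [leRHS]big_seq_cond.
by apply: ler_sum => x /andP[]; exact: hwt.
Qed.

Definition admissible zeta xi p q r f K := [/\ analytic_on_disk f, cabs (f 0) = 1,
  0 < K & growth_bound zeta xi p q r K f].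

(** Zeros are classified by [1 - |w|] and [|w - xi|]. In each class the weight cancels the powers
    [2^(k p)] and [2^(J g)] of the mass bound, leaving [2^(- k eps)], which is shared between the
    two indices since [J <= k + 4]. *)
Lemma sum_far_from_zeta zeta xi p q r eps (b : R) : cabs zeta = 1 -> cabs xi = 1 ->
  0 <= p -> 0 <= q -> 0 <= r -> 0 < eps -> 0 < b ->
  exists2 C : R, 0 < C & forall f K (A : seq (R[i] * nat)),
    admissible zeta xi p q r f K -> uniq A ->
    (forall x, x \in A -> zeros_mult f x /\ b <= cabs (x.1 - zeta)) ->
    \sum_(x <- A) zero_weight zeta xi p q r eps x.1 <= C * K.
Proof.
move=> zeta1 xi1 p0 q0 r0 eps0 b0.
have [C C0 hC] := zero_mass_away_xi zeta1 xi1 p0 q0 r0 eps0.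
have [idx hidx] := exists_dyadic_index.
pose g := pospart (q - 1 + eps); pose s := Num.min p r.
have g0 : 0 <= g by rewrite le_max lexx orbT.
pose E := (1 - pow2 (- (eps / 4)))^-1.
have e4 : 0 < eps / 4 by rewrite divr_gt0.
have E0 : 0 < E by rewrite invr_gt0 subr_gt0 pow2_lt1// oppr_lt0.
pose c1 := pow2 eps * C * 12 `^ g * b `^ (- s).
have c10 : 0 < c1 by rewrite !mulr_gt0 ?pow2_gt0 ?powR_gt0.
exists (c1 * (E * E)); first exact: mulr_gt0 c10 (mulr_gt0 E0 E0).
move=> f K A [af f0 K0 fK] uA hA.
pose k (x : R[i] * nat) := idx (1 - cabs x.1).
(* [12 = 2 * 6]: the lower bound [2^-(J+1)] on the quotient then reads [|w - xi| > 6 * 2^-J], as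
   [zero_mass_away_xi] requires. *)
pose J (x : R[i] * nat) := idx (cabs (x.1 - xi) / 12).
have kP x : x \in A -> pow2 (- (k x).+1%:R) < 1 - cabs x.1 /\
    1 - cabs x.1 <= pow2 (- (k x)%:R).
  move=> /hA[[x1 _] _]; apply: hidx; first by rewrite subr_gt0.
  by rewrite gerBl cabs_ge0.
have JP x : x \in A -> pow2 (- (J x).+1%:R) < cabs (x.1 - xi) / 12 /\
    cabs (x.1 - xi) / 12 <= pow2 (- (J x)%:R).
  move=> /hA[[x1 _] _]; apply: hidx.
    by rewrite divr_gt0// (lt_le_trans _ (le_cabsB _ xi1))// subr_gt0.
  by have := cabsB_lt2 xi1 x1; lra.
rewrite mulrAC.
apply: (@dyadic_double_sum _ _ _ _ k J) => //; first exact: mulr_ge0 (ltW c10) (ltW K0).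
move=> k' J'.
apply: (@class_sum_le A _ (zero_weight zeta xi p q r eps)
  (pow2 (- (k'%:R * (p + eps))) * (12 * pow2 (- J'%:R)) `^ g * b `^ (- s))
  (C * K * pow2 (k'%:R * p) * pow2 (J'%:R * g))).
- by rewrite !mulr_ge0 ?pow2_ge0 ?powR_ge0.
- apply: mulr_ge0 (mulr_ge0 (ltW c10) (ltW K0)) _.
  by apply: mulr_ge0; exact: pow2_ge0.
- move=> x xA /andP[/eqP <- /eqP <-].
  have [[x1 _] bx] := hA x xA; have [_ kx] := kP x xA; have [_ Jx] := JP x xA.
  by apply: zero_weight_le => //; move: Jx; lra.
move=> x0 x0A /andP[/eqP k0 /eqP J0].
have [Jx1 Jx2] := JP x0 x0A; have [kx1 kx2] := kP x0 x0A; rewrite J0 k0 in Jx1 Jx2 kx1 kx2.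
have [[x01 _] _] := hA x0 x0A.
have J'0 : (0 < J')%N.
  rewrite lt0n; apply/eqP => J'0; move: Jx1; rewrite J'0 pow2N pow2_1.
  by have := cabsB_lt2 xi1 x01; lra.
(* [2^-(k+1) < 1 - |w| <= |w - xi| <= 12 * 2^-J <= 2^(4-J)]. *)
have Jk : (J' <= k' + 4)%N.
  have p16 : pow2 4 = 16 :> R by rewrite /pow2 powR_mulrn// -natrX.
  have : pow2 (- k'.+1%:R) < pow2 (4 - J'%:R) :> R.
    rewrite pow2D p16; have := le_cabsB x0.1 xi1; have := pow2_ge0 (- J'%:R : R); lra.
  move=> h; rewrite leqNgt; apply/negP => kJ; move: h; apply/negP; rewrite -leNgt le_pow2//.
  have : (k' + 5)%:R <= J'%:R :> R by rewrite ler_nat addnS.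
  by rewrite natrD -natr1; lra.
split.
  apply: (hC f K _ k' J') => //.
    apply: zero_list_map; first exact: filter_uniq.
    by move=> x; rewrite mem_filter => /andP[_ /hA[]].
  move=> w /mapP[x]; rewrite mem_filter => /andP[/andP[/eqP kx /eqP Jx] xA] ->.
  have [h1 _] := kP x xA; have [h2 _] := JP x xA; rewrite kx Jx in h1 h2.
  split; first exact: ltW.
  by move: h2; rewrite pow2_succ; lra.
rewrite powRM ?pow2_ge0// -pow2M.
have eJ : pow2 (J'%:R * g) = (pow2 (- J'%:R * g))^-1 by rewrite -pow2N mulNr opprK.
have -> : pow2 (- (k'%:R * (p + eps))) * (12 `^ g * pow2 (- J'%:R * g)) * b `^ (- s) *
   (C * K * pow2 (k'%:R * p) * pow2 (J'%:R * g)) =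
   C * 12 `^ g * b `^ (- s) * K * pow2 (- (k'%:R * eps)).
  rewrite eJ mulrDr opprD pow2D [pow2 (- (k'%:R * p))]pow2N.
  by field; rewrite !gt_eqF ?pow2_gt0.
have h : pow2 (- (k'%:R * eps)) <=
    pow2 eps * (pow2 (- (k'%:R * (eps / 4))) * pow2 (- (J'%:R * (eps / 4)))).
  rewrite -!pow2D le_pow2//.
  have h1 : J'%:R * eps <= (k'%:R + 4) * eps.
    by rewrite ler_wpM2r ?(ltW eps0)// -natrD ler_nat.
  have h2 : 0 <= k'%:R * eps by rewrite mulr_ge0// ltW.
  by rewrite !mulrA; lra.
have c20 : 0 <= C * 12 `^ g * b `^ (- s) * K.
  by rewrite !mulr_ge0 ?powR_ge0 ?(ltW C0) ?(ltW K0).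
apply: le_trans (ler_wpM2l c20 h) _.
by rewrite le_eqVlt; apply/orP; left; apply/eqP; rewrite /c1; ring.
Qed.

(** Zeros are classified by [1 - |w|] and [|w - zeta|]. The gain [2^(- J min(p, r))] in the mass
    cancels the singular weight at [zeta], and [|w - xi|] is simply bounded by 2. *)
Lemma sum_near_zeta zeta xi p q r eps (j0 : nat) : cabs zeta = 1 -> cabs xi = 1 ->
  zeta != xi -> 0 <= p -> 0 <= q -> 0 <= r -> 0 < eps ->
  4 * pow2 (- j0%:R) <= cabs (zeta - xi) ->
  exists2 C : R, 0 < C & forall f K (A : seq (R[i] * nat)),
    admissible zeta xi p q r f K -> uniq A ->
    (forall x, x \in A -> zeros_mult f x /\ cabs (x.1 - zeta) <= pow2 (- j0%:R)) ->
    \sum_(x <- A) zero_weight zeta xi p q r eps x.1 <= C * K.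
Proof.
move=> zeta1 xi1 zx p0 q0 r0 eps0 hj0.
(* The loss [2^(J kap (p + q))] is then at most [2^(J eps / 2)]; as [J <= k], the factor
   [2^(- k eps)] absorbs it and still decays in both indices. *)
pose kap := Num.min 1 (eps / 2 / (p + q + 1)).
have pq1 : 0 < p + q + 1 by rewrite ltr_wpDl// addr_ge0.
have kap0 : 0 < kap by rewrite lt_min ltr01 !divr_gt0.
have kap1 : kap <= 1 by rewrite ge_min lexx.
have kape : kap * (p + q) <= eps / 2.
  apply: (@le_trans _ _ (kap * (p + q + 1))).
    by rewrite ler_wpM2l ?(ltW kap0)// lerDl.
  by rewrite -ler_pdivlMr// ge_min lexx orbT.
have [C C0 hC] := zero_mass_near_zeta zeta1 xi1 zx p0 q0 r0 kap0 kap1.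
have [idx hidx] := exists_dyadic_index.
pose g := pospart (q - 1 + eps); pose s := Num.min p r.
have g0 : 0 <= g by rewrite le_max lexx orbT.
pose E := (1 - pow2 (- (eps / 4)))^-1.
have e4 : 0 < eps / 4 by rewrite divr_gt0.
have E0 : 0 < E by rewrite invr_gt0 subr_gt0 pow2_lt1// oppr_lt0.
pose c1 := C * 2 `^ g * pow2 s.
have c10 : 0 < c1 by rewrite !mulr_gt0 ?pow2_gt0 ?powR_gt0.
exists (c1 * (E * E)); first exact: mulr_gt0 c10 (mulr_gt0 E0 E0).
move=> f K A [af f0 K0 fK] uA hA.
pose k (x : R[i] * nat) := idx (1 - cabs x.1).
pose J (x : R[i] * nat) := idx (cabs (x.1 - zeta)).
have kP x : x \in A -> pow2 (- (k x).+1%:R) < 1 - cabs x.1 /\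
    1 - cabs x.1 <= pow2 (- (k x)%:R).
  move=> /hA[[x1 _] _]; apply: hidx; first by rewrite subr_gt0.
  by rewrite gerBl cabs_ge0.
have JP x : x \in A -> pow2 (- (J x).+1%:R) < cabs (x.1 - zeta) /\
    cabs (x.1 - zeta) <= pow2 (- (J x)%:R).
  move=> /hA[[x1 _] hx]; apply: hidx.
    by rewrite (lt_le_trans _ (le_cabsB _ zeta1))// subr_gt0.
  by rewrite (le_trans hx)// pow2_le1// oppr_le0.
rewrite mulrAC.
apply: (@dyadic_double_sum _ _ _ _ k J) => //; first exact: mulr_ge0 (ltW c10) (ltW K0).
move=> k' J'.
apply: (@class_sum_le A _ (zero_weight zeta xi p q r eps)
  (pow2 (- (k'%:R * (p + eps))) * 2 `^ g * pow2 (- J'.+1%:R) `^ (- s))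
  (C * K * pow2 (k'%:R * p) * pow2 (- (J'%:R * s)) * pow2 (J'%:R * kap * (p + q)))).
- by rewrite !mulr_ge0 ?pow2_ge0 ?powR_ge0.
- apply: mulr_ge0 (mulr_ge0 (ltW c10) (ltW K0)) _.
  by apply: mulr_ge0; exact: pow2_ge0.
- move=> x xA /andP[/eqP <- /eqP <-].
  have [[x1 _] bx] := hA x xA; have [_ kx] := kP x xA; have [Jx _] := JP x xA.
  by apply: zero_weight_le; rewrite ?pow2_gt0 ?(ltW Jx)// ltW// cabsB_lt2.
move=> x0 x0A /andP[/eqP k0 /eqP J0].
have [Jx1 Jx2] := JP x0 x0A; have [kx1 kx2] := kP x0 x0A; rewrite J0 k0 in Jx1 Jx2 kx1 kx2.
have [[x01 _] hx0] := hA x0 x0A.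
have J'0 : (j0 <= J')%N.
  by rewrite -ltnS; apply: lt_pow2_nat; exact: lt_le_trans Jx1 hx0.
have Jk : (J' <= k')%N.
  rewrite -ltnS; apply: lt_pow2_nat; apply: lt_le_trans kx1 _.
  exact: le_trans (le_cabsB _ zeta1) Jx2.
split.
  apply: (hC f K _ k' J') => //.
  - apply: zero_list_map; first exact: filter_uniq.
    by move=> x; rewrite mem_filter => /andP[_ /hA[]].
  - apply: le_trans hj0; rewrite ler_wpM2l// le_pow2// lerN2 ler_nat//.
  - by rewrite (leq_trans Jk)// -addn2 leq_addr.
  move=> w /mapP[x]; rewrite mem_filter => /andP[/andP[/eqP kx /eqP Jx] xA] ->.
  have [h1 _] := kP x xA; have [_ h2] := JP x xA; rewrite kx Jx in h1 h2.
  by split => //; exact: ltW.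
have -> : pow2 (- J'.+1%:R) `^ (- s) = pow2 s * (pow2 (- (J'%:R * s)))^-1.
  rewrite -pow2M -pow2N -pow2D; congr pow2; rewrite -natr1; ring.
have -> : pow2 (- (k'%:R * (p + eps))) * 2 `^ g * (pow2 s * (pow2 (- (J'%:R * s)))^-1) *
   (C * K * pow2 (k'%:R * p) * pow2 (- (J'%:R * s)) * pow2 (J'%:R * kap * (p + q))) =
   C * 2 `^ g * pow2 s * K * (pow2 (- (k'%:R * eps)) * pow2 (J'%:R * kap * (p + q))).
  rewrite mulrDr opprD [pow2 (- (k'%:R * p) + _)]pow2D [pow2 (- (k'%:R * p))]pow2N.
  by field; rewrite !gt_eqF ?pow2_gt0.
have h : pow2 (- (k'%:R * eps)) * pow2 (J'%:R * kap * (p + q)) <=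
    pow2 (- (k'%:R * (eps / 4))) * pow2 (- (J'%:R * (eps / 4))).
  rewrite -!pow2D le_pow2//.
  have h1 : J'%:R * eps <= k'%:R * eps.
    by rewrite ler_wpM2r ?(ltW eps0)// ler_nat.
  have h2 : J'%:R * (kap * (p + q)) <= J'%:R * (eps / 2) by rewrite ler_wpM2l.
  by rewrite !mulrA in h2 *; lra.
rewrite -/c1; apply: ler_wpM2l h.
exact: mulr_ge0 (ltW c10) (ltW K0).
Qed.

End WeightedSums.

Theorem theorem0p4 (R : realType) (zeta0 xi0 : R[i])
  (hz0 : cabs zeta0 = 1) (hx0 : cabs xi0 = 1) (hne : zeta0 != xi0)
  (p q r eps : R) (hp : 0 <= p) (hq : 0 <= q) (hr : 0 <= r) (heps : 0 < eps) :
  exists C5 : R, 0 < C5 /\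
    forall (f : R[i] -> R[i]) (K : R),
      analytic_on_disk f -> cabs (f 0) = 1 -> 0 < K ->
      (forall z : R[i], cabs z < 1 -> f z != 0 ->
         ln (cabs (f z)) <=
           K / (1 - cabs z) `^ p * (cabs (z - zeta0) `^ r / cabs (z - xi0) `^ q)) ->
      (\esum_(x in zeros_mult f)
         ((1 - cabs x.1) `^ (p + 1 + eps)
          * cabs (x.1 - xi0) `^ (pospart (q - 1 + eps))
          / cabs (x.1 - zeta0) `^ (Num.min p r))%:E <= (C5 * K)%:E)%E.
Proof.
have d0 : 0 < cabs (zeta0 - xi0) / 4 by rewrite divr_gt0// cabs_gt0 subr_eq0.
(* The zeros are split at distance [2^-j0] from [zeta0], at most a quarter of the distance to
   [xi0]. *)
have [j0 hj0] := pow2_small d0.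
have hj0' : 4 * pow2 (- j0%:R) <= cabs (zeta0 - xi0) by lra.
have [C1 C10 H1] := sum_far_from_zeta hz0 hx0 hp hq hr heps (pow2_gt0 (- j0%:R)).
have [C2 C20 H2] := sum_near_zeta hz0 hx0 hne hp hq hr heps hj0'.
exists (C1 + C2); split; first exact: addr_gt0.
move=> f K af f0 K0 fK; have hyp : admissible zeta0 xi0 p q r f K by [].
(* The sum is a supremum over finite sets of zeros, each enumerated below by a duplicate-free
   list. *)
apply: ge_ereal_sup => _ [A [/finite_seqP[t At] subA] <-].
have {}At : A = [set` undup t].
  by rewrite At; apply/seteqP; split=> x /=; rewrite mem_undup.
have uA := undup_uniq t; move: (undup t) At uA => {}t At uA.
have hA x : x \in t -> zeros_mult f x by move=> xt; apply: subA; rewrite At.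
rewrite At -fsbig_seq// sumEFin lee_fin.
pose P (x : R[i] * nat) := pow2 (- j0%:R) <= cabs (x.1 - zeta0).
rewrite (bigID P)/= mulrDl lerD//.
  rewrite -big_filter; apply: (H1 f K _ hyp); first exact: filter_uniq uA.
  by move=> x; rewrite mem_filter => /andP[Px /hA].
rewrite -big_filter; apply: (H2 f K _ hyp); first exact: filter_uniq uA.
by move=> x; rewrite mem_filter -ltNge => /andP[/ltW Px /hA].
Qed.
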